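(* Consider the two-color urn with sample size $m$ and replacement matrix $$Q_n=\begin{pmatrix}X_n & 0\\ 0 & Y_n\end{pmatrix},$$ that is, $W_n=W_{n-1}+X_n\xi_n$ and $B_n=B_{n-1}+Y_n(m-\xi_n)$ for $n\ge 1$. Then the following hold. 1. If $\mu_X>\mu_Y$, then almost surely as $n\to\infty$, $$T_n=m\mu_Xn+o(n),\quad W_n=m\mu_Xn+o(n),\quad B_n=B_\infty n^\rho+o(n^\rho),$$ where $\rho=\frac{\mu_Y}{\mu_X}$ and $B_\infty$ is a positive random variable. 2. If $\mu_X=\mu_Y$, then almost surely as $n\to\infty$, $$T_n=m\mu_Xn+o(n),\quad W_n=W_\infty n+o(n),\quad B_n=(\mu_Xm-W_\infty)\,n+o(n),$$ where $W_\infty$ is a positive random variable.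
   Context: Urn model: fix an integer $m\ge 1$. An urn contains white and blue balls; $W_n$, $B_n$ and $T_n=W_n+B_n$ denote the numbers of white balls, blue balls and all balls after $n$ steps, with $T_0=W_0+B_0\ge m$. Let $(X_n)$ and $(Y_n)$ be sequences of strictly positive independent identically distributed discrete random variables with finite means $\mu_X,\mu_Y$ and finite variances. At step $n$ a sample of $m$ balls is drawn from the urn; $\xi_n$ is the number of white balls in the sample. The sample is returned together with additional balls whose numbers (white, blue) are given by the vector $Q_n(\xi_n,m-\xi_n)^t$, so that $(W_n,B_n)^t=(W_{n-1},B_{n-1})^t+Q_n(\xi_n,m-\xi_n)^t$. Let $\mathcal F_n$ be the $\sigma$-field generated by the first $n$ draws (samples and added balls). Then $\mathbb P[\xi_n=k\mid\mathcal F_{n-1}]=\binom{W_{n-1}}{k}\binom{B_{n-1}}{m-k}/\binom{T_{n-1}}{m}$, and $(X_n,Y_n)$ is independent of $(\mathcal F_{n-1},\xi_n)$. *)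

(* Defs.v *)
(* MathComp + MathComp-Analysis *)
From HB Require Import structures.
From mathcomp Require Import all_boot all_order all_algebra.
From mathcomp Require Import all_classical all_reals all_analysis.

Set Implicit Arguments.
Unset Strict Implicit.
Unset Printing Implicit Defensive.

Import Order.TTheory GRing.Theory Num.Theory.
Import numFieldNormedType.Exports.

Local Open Scope classical_set_scope.
Local Open Scope ring_scope.

(* Sub-sigma-algebras of the sigma-algebra of Omega are represented by sets of
   sets, as in the library's <<s G >>. *)

Definition indep_sigma (d : measure_display) (Omega : measurableType d)
    (R : realType) (P : probability Omega R) (G H : set (set Omega)) : Prop :=
  forall A B, G A -> H B -> P (A `&` B) = (P A * P B)%E.

(* g is a version of the conditional probability P[E | G]. *)
Definition is_cond_prob (d : measure_display) (Omega : measurableType d)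
    (R : realType) (P : probability Omega R)
    (G : set (set Omega)) (E : set Omega) (g : Omega -> R) : Prop :=
  (forall S : set R, measurable S -> G (g @^-1` S)) /\
  (forall A, G A -> (\int[P]_(w in A) (g w)%:E = P (A `&` E))%E).

(* Every subset of nat is measurable, hence the unrestricted sets of values
   below; the same holds for the countable types nat * nat and
   nat * nat * nat. *)
Definition iid (d : measure_display) (Omega : measurableType d)
    (R : realType) (P : probability Omega R) (Z : nat -> {RV P >-> nat}) : Prop :=
  (forall (s : seq nat) (C : nat -> set nat), uniq s ->
     P (\bigcap_(i in [set` s]) (Z i @^-1` C i)) =
       (\prod_(i <- s) P (Z i @^-1` C i))%E) /\
  (forall (i j : nat) (C : set nat), P (Z i @^-1` C) = P (Z j @^-1` C)).

Section urn.
Variables (d : measure_display) (Omega : measurableType d) (R : realType).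
Variables (P : probability Omega R) (m : nat).
Variables (X Y xi : nat -> {RV P >-> nat}).

(* F_n: the k-th draw reveals the sample and the numbers of white and of blue
   balls added, for 1 <= k <= n. In particular X_k is not revealed when
   xi_k = 0, nor Y_k when xi_k = m. *)
Definition draws_sigma (n : nat) : set (set Omega) :=
  <<s [set A | exists (k : nat) (C : set (nat * nat * nat)),
         (1 <= k <= n)%N /\
         A = [set w | C (xi k w, X k w * xi k w, Y k w * (m - xi k w))%N]] >>.

Definition draws_sample_sigma (n : nat) : set (set Omega) :=
  <<s draws_sigma n.-1 `|` [set A | exists C : set nat, A = xi n @^-1` C] >>.

Definition pair_sigma (n : nat) : set (set Omega) :=
  [set A | exists C : set (nat * nat), A = [set w | C (X n w, Y n w)]].

(* Indices start at 1 for X, Y and xi (their values at 0 are irrelevant) and at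
   0 for W and B; the initial composition (w0, b0) is deterministic. *)
Record diagonal_urn (w0 b0 : nat) (W B : nat -> Omega -> nat) : Prop := {
  urn_pos : forall n w, (1 <= n)%N -> (0 < X n w)%N /\ (0 < Y n w)%N;
  urn_iidX : iid (fun n => X n.+1);
  urn_iidY : iid (fun n => Y n.+1);
  urn_W0 : forall w, W 0%N w = w0;
  urn_B0 : forall w, B 0%N w = b0;
  urn_sample : forall n w, (1 <= n)%N -> (xi n w <= m)%N;
  urn_W : forall n w, (1 <= n)%N ->
    W n w = (W n.-1 w + X n w * xi n w)%N;
  urn_B : forall n w, (1 <= n)%N ->
    B n w = (B n.-1 w + Y n w * (m - xi n w))%N;
  urn_draw : forall n k, (1 <= n)%N -> (k <= m)%N ->
    is_cond_prob P (draws_sigma n.-1) (xi n @^-1` [set k])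
      (fun w => ('C(W n.-1 w, k) * 'C(B n.-1 w, m - k))%:R
                / ('C(W n.-1 w + B n.-1 w, m))%:R);
  urn_indep : forall n, (1 <= n)%N ->
    indep_sigma P (pair_sigma n) (draws_sample_sigma n)
}.

End urn.

(* Main.v *)
Require Import Defs.
From HB Require Import structures.
From mathcomp Require Import all_boot all_order all_algebra.
From mathcomp Require Import all_classical all_reals all_analysis.
From mathcomp Require Import measurable_realfun ring lra.

(** Write S_n for the sum of 1 / T_k over k < n. The theorem rests on the fact
    that each color present at the start grows like an exponential of S_n:
    almost surely W_n / exp (m mu_X S_n) and B_n / exp (m mu_Y S_n) converge to
    positive limits ([ae_growth]).

    Let U be the count of one color, z_n the number of balls of that color in
    the next sample, and A_n the factor applied to it. The relative increment
    r_n = A_n z_n / U_n has conditional mean m mu / T_n, because the sample is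
    hypergeometric and A_n is independent of the past and of the sample. Hence
    r_n - m mu / T_n is a martingale difference. Its variances are summable:
    U_n + z_n <= U_{n+1} because A_n >= 1, so that the terms
    1 / U_n - 1 / U_{n+1}, whose sum telescopes, dominate a constant multiple of
    z_n / U_n^2 on every path ([draw_sq_sum_le]), and
    E r_n^2 = E A^2 * E (z_n / U_n)^2. Therefore the martingale converges almost
    surely ([martingale_cvg]) and the sum of the r_n^2 is almost surely finite.
    As ln (1 + x) differs from x by at most x^2, ln U_n - m mu S_n converges.

    The rest is deterministic. If T_n / exp (c S_n) has a positive limit l, then
    exp (c S_{n+1}) - exp (c S_n) is asymptotic to c exp (c S_n) / T_n, which
    tends to c / l, and averaging gives exp (c S_n) / n --> c / l and
    T_n / n --> c ([cvg_expR_series_linear], [cvg_linear_of_ratio]). When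
    mu_X > mu_Y the white balls dominate T_n because S_n is unbounded, and
    exp (m mu_Y S_n) is the power mu_Y / mu_X of exp (m mu_X S_n), which yields
    the exponent rho ([dominant_color_asymptotics]). When mu_X = mu_Y both
    colors grow at the same rate ([balanced_asymptotics]); if the urn starts
    without blue balls, it almost surely never contains any
    ([absorbed_at_zero]).

    Conditioning is elementary throughout: the past is a random variable with
    countably many values, so conditional expectations are integrals over the
    events that fix its value. *)

Set Implicit Arguments.
Unset Strict Implicit.
Unset Printing Implicit Defensive.

Import Order.TTheory GRing.Theory Num.Theory.
Import numFieldNormedType.Exports.

Local Open Scope classical_set_scope.
Local Open Scope ring_scope.

(** * Sequences that grow like the exponential of a series *)

Section growth_along_a_path.
Context {R : realType}.
Implicit Types (u v w t : R ^nat) (a c l : R).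

Lemma cvg_near_eq u v l : u @ \oo --> l ->
  (\forall n \near \oo, u n = v n) -> v @ \oo --> l.
Proof.
move=> ul uv; apply: cvg_trans ul; apply: near_eq_cvg.
by apply: filterS uv => n ->.
Qed.

Lemma cvgM_near u v w a c : u @ \oo --> a -> v @ \oo --> c ->
  (\forall n \near \oo, u n * v n = w n) -> w @ \oo --> a * c.
Proof. by move=> ua vc; apply: cvg_near_eq; exact: cvgM. Qed.

Lemma cvgD_near u v w a c : u @ \oo --> a -> v @ \oo --> c ->
  (\forall n \near \oo, u n + v n = w n) -> w @ \oo --> a + c.
Proof. by move=> ua vc; apply: cvg_near_eq; exact: cvgD. Qed.

(** Applying ln (1 + y) <= y to the inverse of 1 + x bounds ln (1 + x) below by
    x / (1 + x), which is at least x - x^2. *)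
Lemma ln1Dx_quadratic (x : R) : 0 <= x -> x - ln (1 + x) <= x ^+ 2.
Proof.
move=> x0; have x1 : 0 < 1 + x by rewrite ltr_wpDr.
have : ln (1 + ((1 + x)^-1 - 1)) <= (1 + x)^-1 - 1.
  by apply: le_ln1Dx; rewrite ltrBDl subrr invr_gt0.
rewrite subrKC lnV ?posrE// => h.
rewrite -subr_ge0; apply: (@le_trans _ _ (ln (1 + x) - 1 + (1 + x)^-1)); first lra.
suff -> : x ^+ 2 - (x - ln (1 + x)) =
  ln (1 + x) - 1 + (1 + x)^-1 + x ^+ 3 / (1 + x).
  by rewrite lerDl divr_ge0 ?exprn_ge0 ?(ltW x1).
by field; rewrite gt_eqF.
Qed.

(** Summing ln (u_{k+1} / u_k) = ln (1 + r_k) where r_k is the relative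
    increment: the two hypotheses control the sum of r_k - ln (1 + r_k), which is
    dominated by r_k^2, and the sum of r_k - v_k. *)
Lemma cvg_ratio_expR_series u v : (forall n, 0 < u n) ->
  {homo u : i j / (i <= j)%N >-> i <= j} ->
  cvgn (series (fun k => ((u k.+1 - u k) / u k) ^+ 2)) ->
  cvgn (series (fun k => (u k.+1 - u k) / u k - v k)) ->
  exists2 l : R, 0 < l & u n / expR (series v n) @[n --> \oo] --> l.
Proof.
move=> u0 u_nd sq_cvg dif_cvg.
pose r k := (u k.+1 - u k) / u k.
have r0 k : 0 <= r k by rewrite divr_ge0 ?(ltW (u0 k))// subr_ge0 u_nd.
have ur k : u k.+1 = u k * (1 + r k).
  by rewrite /r; field; rewrite gt_eqF.
have def_cvg : cvgn (series (fun k => r k - ln (1 + r k))).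
  apply: series_le_cvg sq_cvg => n.
  - by rewrite subr_ge0 le_ln1Dx// (lt_le_trans _ (r0 n))// ltrN10.
  - exact: sqr_ge0.
  - exact: ln1Dx_quadratic.
have [l Hl] : exists l : R, ln (u n) - series v n @[n --> \oo] --> l.
  have cv := is_cvg_seriesB dif_cvg def_cvg.
  exists (limn (series ((fun k => r k - v k) - (fun k => r k - ln (1 + r k))))
    + ln (u 0%N)).
  have -> : (fun n => ln (u n) - series v n) =
    (fun n => series ((fun k => r k - v k) - (fun k => r k - ln (1 + r k))) n
      + ln (u 0%N)).
    apply/funext; elim=> [|n IHn].
      by rewrite !seriesEnat/= !big_geq// subr0 add0r.
    rewrite !seriesSr/= ur lnM ?posrE//; last by rewrite ltr_wpDr.
    rewrite !fctE; move: IHn; lra.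
  by apply: cvgD => //; exact: cvg_cst.
exists (expR l); first exact: expR_gt0.
have -> : (fun n => u n / expR (series v n)) =
    (fun n => expR (ln (u n) - series v n)).
  by apply/funext => n; rewrite expRD expRN lnK ?posrE.
exact: (continuous_cvg _ (@continuous_expR R l) Hl).
Qed.

(** The inverse of the bound 1 - x <= exp (- x). *)
Lemma expR_sub1_le (x : R) : 0 <= x < 1 -> expR x - 1 <= x / (1 - x).
Proof.
move=> /andP[x0 x1]; have x1' : 0 < 1 - x by rewrite subr_gt0.
have : 1 - x <= expR (- x) by exact: expR_ge1Dx.
rewrite expRN => h.
have : expR x <= (1 - x)^-1.
  by rewrite -[leLHS]invrK lef_pV2 ?posrE ?invr_gt0 ?expR_gt0.
suff -> : x / (1 - x) = (1 - x)^-1 - 1 by move=> ?; rewrite lerD2r.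
by field; rewrite gt_eqF.
Qed.

(** Let e_n be the exponential on the left. Since t_n tends to infinity,
    e_{n+1} - e_n = e_n (exp (c / t_n) - 1) is asymptotic to c e_n / t_n, whose
    limit is c / l; the Cesaro mean of these differences is e_n / n up to a
    vanishing term. *)
Lemma cvg_expR_series_linear t c l : 0 <= c -> 0 < l ->
  (forall n, 0 < t n) -> t @ \oo --> +oo ->
  t n / expR (c * series (fun k => (t k)^-1) n) @[n --> \oo] --> l ->
  expR (c * series (fun k => (t k)^-1) n) / n%:R @[n --> \oo] --> c / l.
Proof.
move=> c0 l0 t0 t_oo tl.
pose e n := expR (c * series (fun k => (t k)^-1) n).
have {}tl : t n / e n @[n --> \oo] --> l by exact: tl.
suff: e n / n%:R @[n --> \oo] --> c / l by [].
have e0 n : 0 < e n by exact: expR_gt0.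
have th0 : (t n)^-1 @[n --> \oo] --> 0 by apply/gtr0_cvgV0 => //; exact: nearW.
have eh : c * (e n / t n) @[n --> \oo] --> c / l.
  under eq_cvg => n do rewrite -[e n / t n]invf_div.
  by apply: cvgM; [exact: cvg_cst|apply: cvgV => //; rewrite gt_eqF].
have eS n : e n.+1 - e n = e n * (expR (c / t n) - 1).
  by rewrite /e seriesSr mulrDr expRD mulrBr mulr1.
have tel : telescope e @ \oo --> c / l.
  have ub : c * (e n / t n) / (1 - c / t n) @[n --> \oo] --> c / l.
    rewrite -[X in _ --> X]divr1; apply: cvgM => //; apply: cvgV.
      by rewrite oner_neq0.
    rewrite -[X in _ --> X]subr0; apply: cvgB; first exact: cvg_cst.
    by rewrite -[X in _ --> X](mulr0 c); apply: cvgM; [exact: cvg_cst|].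
  apply: (squeeze_cvgr _ eh ub); near=> n.
  have ct0 : 0 <= c / t n by rewrite divr_ge0// ltW.
  have ct1 : c / t n < 1.
    rewrite ltr_pdivrMr// mul1r; near: n.
    by move/cvgryPgt : t_oo; apply.
  rewrite /telescope/= eS; apply/andP; split.
    rewrite mulrCA ler_wpM2l ?(ltW (e0 n))// lerBrDl.
    exact: expR_ge1Dx.
  rewrite mulrCA -mulrA ler_wpM2l ?(ltW (e0 n))//.
  by apply: expR_sub1_le; rewrite ct0.
have := cesaro tel; rewrite /arithmetic_mean/= => ces.
rewrite -(cvg_shiftS (fun n => e n / n%:R)).
have -> : (fun n => e n.+1 / n.+1%:R) =
  (fun n => n.+1%:R^-1 * series (telescope e) n.+1 + e 0%N * n.+1%:R^-1).
  apply/funext => n; rewrite telescopeK/=.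
  by field; rewrite ?pnatr_eq0 addrC natr1 pnatr_eq0.
rewrite -[c / l]addr0; apply: cvgD => //.
rewrite -(mulr0 (e 0%N)); apply: cvgM; first exact: cvg_cst.
exact: cvg_harmonic.
Unshelve. all: by end_near. Qed.

Lemma cvg_linear_of_ratio t c l : 0 <= c -> 0 < l ->
  (forall n, 0 < t n) -> t @ \oo --> +oo ->
  t n / expR (c * series (fun k => (t k)^-1) n) @[n --> \oo] --> l ->
  t n / n%:R @[n --> \oo] --> c.
Proof.
move=> c0 l0 t0 t_oo tl.
have el := cvg_expR_series_linear c0 l0 t0 t_oo tl.
have -> : c = l * (c / l) by field; rewrite gt_eqF.
apply: (cvgM_near tl el); near=> n.
by rewrite mulrA divfK// gt_eqF// expR_gt0.
Unshelve. all: by end_near. Qed.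

(** If [s] converged, so would [w + b]; hence [s] tends to infinity and [b] is
    negligible with respect to [w], because [cb < cw]. Then [w + b] satisfies the
    hypothesis of [cvg_linear_of_ratio], and exp (cb s) is the power cb / cw of
    exp (cw s). *)
Lemma dominant_color_asymptotics (w b : R ^nat) (cw cb a be : R) :
  0 < cb < cw -> 0 < a -> 0 < be -> (forall n, 0 < w n + b n) ->
  w n + b n @[n --> \oo] --> +oo ->
  let s := series (fun k => (w k + b k)^-1) in
  w n / expR (cw * s n) @[n --> \oo] --> a ->
  b n / expR (cb * s n) @[n --> \oo] --> be ->
  [/\ (w n + b n) / n%:R @[n --> \oo] --> cw,
      w n / n%:R @[n --> \oo] --> cw &
      exists2 l : R, 0 < l & b n / n%:R `^ (cb / cw) @[n --> \oo] --> l].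
Proof.
move=> /andP[cb0 cbw] a0 be0 t0 t_oo s wa bbe.
have cw0 : 0 < cw by exact: lt_trans cbw.
have s_nd : nondecreasing_seq s.
  by apply: nondecreasing_series => n _ _; rewrite invr_ge0 ltW.
have s_dvg : ~ cvgn s.
  move=> s_cvg.
  have expcvg c : expR (c * s n) @[n --> \oo] --> expR (c * limn s).
    have h : c * s n @[n --> \oo] --> c * limn s.
      by apply: cvgM => //; exact: cvg_cst.
    exact: (continuous_cvg _ (@continuous_expR R (c * limn s)) h).
  have wc : w @ \oo --> a * expR (cw * limn s).
    by apply: (cvgM_near wa (expcvg cw)); near=> n; rewrite divfK// gt_eqF ?expR_gt0.
  have bc : b @ \oo --> be * expR (cb * limn s).
    by apply: (cvgM_near bbe (expcvg cb)); near=> n; rewrite divfK// gt_eqF ?expR_gt0.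
  set L := a * expR (cw * limn s) + be * expR (cb * limn s).
  have tc : w n + b n @[n --> \oo] --> L by exact: cvgD wc bc.
  have /cvgryPgt/(_ (L + 1)) t1 := t_oo.
  have /cvgrPdist_lt/(_ 1 ltr01) t2 := tc.
  have [n []] : exists n, L + 1 < w n + b n /\ `|L - (w n + b n)| < 1.
    by near \oo => n; exists n; split; near: n.
  by rewrite distrC => h1 /ltr_normlP[]; lra.
have s_oo := nondecreasing_dvgn_lt s_nd s_dvg.
(* The contribution of [b] to the total vanishes on the scale of [w]. *)
have rat : expR (cb * s n) / expR (cw * s n) @[n --> \oo] --> 0.
  have -> : (fun n => expR (cb * s n) / expR (cw * s n)) =
      (fun n => expR (- ((cw - cb) * s n))).
    by apply/funext => n; rewrite -expRN -expRD; congr expR; ring.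
  have h : (cw - cb) * s n @[n --> \oo] --> +oo.
    apply/cvgryPge => A; move/cvgryPge: s_oo => /(_ (A / (cw - cb))).
    by apply: filterS => n; rewrite ler_pdivrMr ?subr_gt0// mulrC.
  exact: (cvg_comp _ (fun x : R => expR (- x)) h (@cvgr_expR R)).
have ta : (w n + b n) / expR (cw * s n) @[n --> \oo] --> a.
  rewrite -[a]addr0 -(mulr0 be).
  apply: (@cvgD_near _ (fun n => b n / expR (cw * s n))) wa _ _; last first.
    by near=> n; rewrite mulrDl.
  apply: (cvgM_near bbe rat); near=> n.
  by field; rewrite !gt_eqF ?expR_gt0.
have el := cvg_expR_series_linear (ltW cw0) a0 t0 t_oo ta.
split.
- exact: (cvg_linear_of_ratio (ltW cw0) a0 t0 t_oo ta).
- have -> : cw = a * (cw / a) by field; rewrite gt_eqF.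
  apply: (cvgM_near wa el); near=> n.
  by rewrite mulrA divfK// gt_eqF// expR_gt0.
exists (be * (cw / a) `^ (cb / cw)).
  by rewrite mulr_gt0// powR_gt0// divr_gt0.
have pw : (expR (cw * s n) / n%:R) `^ (cb / cw) @[n --> \oo]
    --> (cw / a) `^ (cb / cw).
  have -> : (cw / a) `^ (cb / cw) = expR (cb / cw * ln (cw / a)).
    by rewrite /powR gt_eqF// divr_gt0.
  have h : cb / cw * ln (expR (cw * s n) / n%:R) @[n --> \oo]
      --> cb / cw * ln (cw / a).
    apply: cvgM; first exact: cvg_cst.
    have cl : {for cw / a, continuous (@ln R)}.
      by apply: continuous_ln; rewrite divr_gt0.
    exact: (continuous_cvg _ cl el).
  have {}h : expR (cb / cw * ln (expR (cw * s n) / n%:R)) @[n --> \oo]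
      --> expR (cb / cw * ln (cw / a)).
    exact: (continuous_cvg _ (@continuous_expR R _) h).
  apply: (cvg_near_eq h).
  near=> n; rewrite /powR gt_eqF// divr_gt0 ?expR_gt0// ltr0n.
  by near: n; exact: nbhs_infty_gt.
apply: (cvgM_near bbe pw); near=> n.
have n0 : 0 < n%:R :> R by rewrite ltr0n; near: n; exact: nbhs_infty_gt.
have -> : expR (cb * s n) = expR (cw * s n) `^ (cb / cw).
  by rewrite -expRM; congr expR; field; rewrite gt_eqF.
have -> : n%:R `^ (cb / cw) = ((n%:R)^-1 `^ (cb / cw))^-1.
  by rewrite -powRN -(powR_inv1 (ltW n0)) -powRrM mulrN mulN1r opprK.
rewrite invrK powRM ?expR_ge0 ?invr_ge0 ?(ltW n0)// mulrA divfK//.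
by rewrite gt_eqF// powR_gt0// expR_gt0.
Unshelve. all: by end_near. Qed.

Lemma balanced_asymptotics (w b : R ^nat) (c a be : R) :
  0 < c -> 0 < a -> 0 <= be -> (forall n, 0 < w n + b n) ->
  w n + b n @[n --> \oo] --> +oo ->
  let s := series (fun k => (w k + b k)^-1) in
  w n / expR (c * s n) @[n --> \oo] --> a ->
  b n / expR (c * s n) @[n --> \oo] --> be ->
  (w n + b n) / n%:R @[n --> \oo] --> c /\
  exists2 l : R, 0 < l & w n / n%:R @[n --> \oo] --> l.
Proof.
move=> c0 a0 be0 t0 t_oo s wa bbe.
have ab0 : 0 < a + be by rewrite ltr_wpDr.
have ta : (w n + b n) / expR (c * s n) @[n --> \oo] --> a + be.
  apply: (cvgD_near wa bbe); near=> n.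
  by rewrite mulrDl.
split; first exact: (cvg_linear_of_ratio (ltW c0) ab0 t0 t_oo ta).
have el := cvg_expR_series_linear (ltW c0) ab0 t0 t_oo ta.
exists (a * (c / (a + be))); first by rewrite mulr_gt0// divr_gt0.
apply: (cvgM_near wa el); near=> n.
by rewrite mulrA divfK// gt_eqF// expR_gt0.
Unshelve. all: by end_near. Qed.

Lemma cvg_littleo_near (u e : nat -> R^o) l :
  (\forall n \near \oo, 0 < e n) -> u n / e n @[n --> \oo] --> l ->
  u = (fun n => l * e n : R^o) +o_\oo e.
Proof.
move=> e0 /cvgrPdist_le ul; apply/eqaddoP => eps eps0.
near=> n; have en0 : 0 < e n by near: n.
have -> : (u - (fun n => l * e n : R^o)) n = - ((l - u n / e n) * e n).
  by rewrite !fctE; field; rewrite gt_eqF.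
rewrite normrN normrM ler_wpM2r//; near: n; exact: ul.
Unshelve. all: by end_near. Qed.

End growth_along_a_path.

(** * Conditioning on a random variable with countably many values *)

Section discrete_conditioning.
Context {d : measure_display} {Omega : measurableType d} {R : realType}.
Variable P : probability Omega R.
Implicit Types (N : Omega -> nat).

Definition discrete N := forall a, measurable (N @^-1` [set a]).

(** For [discrete N] this is measurability with respect to the sigma-algebra
    generated by [N], whatever the codomain of [f]. *)
Definition determined N {V : Type} (f : Omega -> V) :=
  forall w w', N w = N w' -> f w = f w'.

(** A countable union of atoms of [N]: measurability comes for free, for any set
    of values. *)
Lemma determined_preimage N V (f : Omega -> V) (S : set V) :
  discrete N -> determined N f -> measurable (f @^-1` S).
Proof.
move=> dN df; pose I := [set a | exists2 w, N w = a & S (f w)].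
rewrite (_ : f @^-1` S = \bigcup_(a in I) (N @^-1` [set a])).
  by apply: bigcup_measurable => a _; exact: dN.
apply/seteqP; split => [w Sfw|w [a [w' Nw' Sfw'] Nw]].
  by exists (N w) => //; exists w.
by rewrite /preimage/= (df w w')// Nw'.
Qed.

Lemma determined_measurable_fun N d' (V : sigmaRingType d') (f : Omega -> V)
  (D : set Omega) : discrete N -> determined N f -> measurable_fun D f.
Proof.
move=> dN df; apply: (@measurable_funS _ _ _ _ setT) => //.
by move=> _ S _; rewrite setTI; exact: determined_preimage df.
Qed.

Lemma bigcup_atoms N : \bigcup_a (N @^-1` [set a]) = [set: Omega].
Proof. by apply/seteqP; split => // w _; exists (N w). Qed.

Lemma trivIset_atoms N : trivIset [set: nat] (fun a => N @^-1` [set a]).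
Proof. by move=> a b _ _ [w [/= <- <-]]. Qed.

Lemma ge0_integral_atoms N (f : Omega -> \bar R) : discrete N ->
  measurable_fun [set: Omega] f -> (forall w, 0 <= f w)%E ->
  (\int[P]_w f w = \sum_(a <oo) \int[P]_(w in N @^-1` [set a]) f w)%E.
Proof.
move=> dN mf f0; rewrite -(bigcup_atoms N) ge0_integral_bigcup//.
- by rewrite bigcup_atoms.
- exact: trivIset_atoms.
Qed.

Lemma integral_atoms_eq0 N (f : Omega -> \bar R) : discrete N ->
  P.-integrable [set: Omega] f ->
  (forall a, \int[P]_(w in N @^-1` [set a]) f w = 0)%E -> (\int[P]_w f w = 0)%E.
Proof.
move=> dN intf f0; rewrite -(bigcup_atoms N) integral_bigcup//.
- by rewrite eseries0.
- exact: trivIset_atoms.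
- by rewrite bigcup_atoms.
Qed.

(** The hypothesis on the atoms says that [f] has conditional mean zero given
    [N], so [f] is orthogonal to every function of [N]. *)
Lemma integral_mul_determined N (f g : Omega -> R) : discrete N ->
  determined N g -> P.-integrable [set: Omega] (EFin \o f) ->
  P.-integrable [set: Omega] (EFin \o (fun w => g w * f w)) ->
  (forall a, \int[P]_(w in N @^-1` [set a]) (f w)%:E = 0)%E ->
  (\int[P]_w (g w * f w)%:E = 0)%E.
Proof.
move=> dN dg intf intgf f0; apply: (integral_atoms_eq0 dN) => // a.
have [->|/set0P[w0 /= Nw0]] := eqVneq (N @^-1` [set a]) set0.
  exact: integral_set0.
transitivity (\int[P]_(w in N @^-1` [set a]) ((g w0)%:E * (f w)%:E))%E.
  apply: eq_integral => w; rewrite inE/= => Nw.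
  by rewrite (dg w w0)// Nw.
rewrite integralZl ?f0 ?mule0//.
exact: integrableS intf.
Qed.

Lemma ge0_integral_nat_comp (A : set Omega) (X : Omega -> nat) (h : nat -> R) :
  measurable A -> discrete X -> (forall j, 0 <= h j) ->
  (\int[P]_(w in A) (h (X w))%:E =
   \sum_(j <oo) (h j)%:E * P (A `&` X @^-1` [set j]))%E.
Proof.
move=> mA dX h0.
have mAX j : measurable (A `&` X @^-1` [set j]) by apply: measurableI.
have AE : A = \bigcup_j (A `&` X @^-1` [set j]).
  by rewrite -setI_bigcupr bigcup_atoms setIT.
rewrite [in LHS]AE ge0_integral_bigcup//; last 3 first.
- apply: (determined_measurable_fun dX) => w w' XE.
  by rewrite XE.
- by move=> w _; rewrite lee_fin.
- by move=> i j _ _ [w [/= [_ <-] [_ <-]]].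
apply: eq_eseriesr => j _.
transitivity (\int[P]_(w in A `&` X @^-1` [set j]) (cst (h j)%:E w))%E.
  by apply: eq_integral => w; rewrite inE/= => -[_ ->].
by rewrite integral_cst.
Qed.

Lemma integral_indep_set (A : set Omega) (X : Omega -> nat) (h : nat -> R) :
  measurable A -> discrete X -> (forall j, 0 <= h j) ->
  (forall j, P (A `&` X @^-1` [set j]) = P A * P (X @^-1` [set j]))%E ->
  (\int[P]_(w in A) (h (X w))%:E = P A * \int[P]_w (h (X w))%:E)%E.
Proof.
move=> mA dX h0 AX; rewrite !ge0_integral_nat_comp//.
rewrite -[P A]fineK ?fin_num_measure// -nneseriesZl; last first.
  by move=> j _; rewrite mule_ge0// lee_fin.
apply: eq_eseriesr => j _.
by rewrite setTI AX -[P A]fineK ?fin_num_measure// muleCA.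
Qed.

Lemma eq_integral_nat_comp (X Y : Omega -> nat) (h : nat -> R) :
  discrete X -> discrete Y -> (forall j, 0 <= h j) ->
  (forall j, P (X @^-1` [set j]) = P (Y @^-1` [set j])) ->
  (\int[P]_w (h (X w))%:E = \int[P]_w (h (Y w))%:E)%E.
Proof.
move=> dX dY h0 XY; rewrite !ge0_integral_nat_comp//.
by apply: eq_eseriesr => j _; rewrite !setTI XY.
Qed.

(** Expectations multiply when [X] is independent of [N]; on each atom of [N] the
    factor [f] is a constant, which reduces the claim to [integral_indep_set]. *)
Lemma integral_mul_indep N (f : Omega -> R) (X : Omega -> nat) (h : nat -> R) :
  discrete N -> determined N f -> (forall w, 0 <= f w) ->
  discrete X -> (forall j, 0 <= h j) ->
  (forall a j, P (N @^-1` [set a] `&` X @^-1` [set j]) =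
     P (N @^-1` [set a]) * P (X @^-1` [set j]))%E ->
  (\int[P]_w (f w * h (X w))%:E =
   (\int[P]_w (h (X w))%:E) * \int[P]_w (f w)%:E)%E.
Proof.
move=> dN df f0 dX h0 NX.
have mh (D : set Omega) : measurable_fun D (fun w => (h (X w))%:E : \bar R).
  by apply: (determined_measurable_fun dX) => w w' ->.
have mf (D : set Omega) : measurable_fun D (fun w => (f w)%:E : \bar R).
  by apply: (determined_measurable_fun dN) => w w' /df ->.
have ih0 : (0 <= \int[P]_w (h (X w))%:E)%E.
  by apply: integral_ge0 => w _; rewrite lee_fin.
move KE : (\int[P]_w (h (X w))%:E)%E ih0 => K K0.
rewrite -ge0_integralZl//; last by move=> w _; rewrite lee_fin.
rewrite !(ge0_integral_atoms dN).
- apply: eq_eseriesr => a _.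
  have [->|/set0P[w0 /= Nw0]] := eqVneq (N @^-1` [set a]) set0.
    by rewrite !integral_set0.
  have Nf w : N w = a -> f w = f w0 by move=> Nw; apply: df; rewrite Nw.
  transitivity (\int[P]_(w in N @^-1` [set a]) ((f w0)%:E * (h (X w))%:E))%E.
    by apply: eq_integral => w; rewrite inE/= => /Nf ->.
  rewrite ge0_integralZl//; [|by move=> w _; rewrite lee_fin|by rewrite lee_fin].
  rewrite integral_indep_set// KE.
  transitivity (\int[P]_(w in N @^-1` [set a])
      cst (K * (f w0)%:E) w)%E; last first.
    by apply: eq_integral => w; rewrite inE/= => /Nf ->.
  by rewrite integral_cst// (muleC (P _)) muleA (muleC _ K).
- exact: emeasurable_funM.
- by move=> w; rewrite mule_ge0// lee_fin.
- by under eq_fun do rewrite EFinM; exact: emeasurable_funM.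
- by move=> w; rewrite lee_fin mulr_ge0.
Qed.

End discrete_conditioning.

(** * Almost sure convergence of martingales with summable variances *)

Section square_integrable.
Context {d : measure_display} {Omega : measurableType d} {R : realType}.
Variable P : probability Omega R.

(** |f| <= 1 + f^2, and constants are integrable for a probability. *)
Lemma integrable_of_sq (N : Omega -> nat) (f : Omega -> R) :
  discrete N -> determined N f ->
  P.-integrable [set: Omega] (EFin \o (fun w => f w ^+ 2)) ->
  P.-integrable [set: Omega] (EFin \o f).
Proof.
move=> dN df intf.
have := integrableD measurableT (finite_measure_integrable_cst P 1 measurableT)
  intf.
apply: le_integrable => //.
  by apply: (determined_measurable_fun dN) => w w' /df /= ->.
move=> w _ /=; rewrite lee_fin [leRHS]ger0_norm ?addr_ge0 ?sqr_ge0//.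
rewrite -[f w ^+ 2]ger0_norm ?sqr_ge0// normrX.
have := normr_ge0 (f w); set x := `|_|; move=> x0; nra.
Qed.

Lemma integrable_sq_of_sum (N : nat -> Omega -> nat) (f : nat -> Omega -> R) :
  (forall n, discrete (N n)) -> (forall n, determined (N n) (f n)) ->
  (\sum_(n <oo) \int[P]_w (f n w ^+ 2)%:E < +oo)%E -> forall n,
  P.-integrable [set: Omega] (EFin \o (fun w => f n w ^+ 2)).
Proof.
move=> dN df sum_lty n; apply/integrableP; split.
  by apply: (determined_measurable_fun (dN n)) => w w' /df /= ->.
apply: le_lt_trans sum_lty.
rewrite (eq_integral (fun w => (f n w ^+ 2)%:E)); last first.
  by move=> w _; rewrite /= ger0_norm ?sqr_ge0.
rewrite (@nneseriesD1 _ _ n)//; last first.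
  by move=> k _; apply: integral_ge0 => w _; rewrite lee_fin sqr_ge0.
rewrite leeDl// nneseries_ge0// => k _ _.
by apply: integral_ge0 => w _; rewrite lee_fin sqr_ge0.
Qed.

End square_integrable.

Section martingale_convergence.
Context {d : measure_display} {Omega : measurableType d} {R : realType}.
Variable P : probability Omega R.
Variables (H : nat -> Omega -> nat) (D : nat -> Omega -> R).
Hypothesis H_discrete : forall n, discrete (H n).
Hypothesis H_nested : forall n, determined (H n.+1) (H n).
Hypothesis D_adapted : forall n, determined (H n.+1) (D n).
Hypothesis D_centered : forall n a,
  (\int[P]_(w in H n @^-1` [set a]) (D n w)%:E = 0)%E.
Hypothesis D_sq_sum : (\sum_(n <oo) \int[P]_w ((D n w) ^+ 2)%:E < +oo)%E.

(** The martingale restarted at time [N] and frozen when its absolute value first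
    reaches [e]. Freezing turns a maximum over time into a value at one time
    ([stopped_reached]) and, since the value before freezing is bounded by [e],
    makes all the products integrable. *)
Fixpoint stopped (e : R) (N k : nat) (w : Omega) : R :=
  if k is k'.+1 then
    let s := stopped e N k' w in
    if e <= `|s| then s else s + D (N + k') w
  else 0.

Lemma stopped_adapted e N k : determined (H (N + k)) (stopped e N k).
Proof.
elim: k => [//|k IHk] w w'; rewrite addnS => Hw /=.
by rewrite (D_adapted Hw) (IHk w w' (H_nested Hw)).
Qed.

Lemma stopped_reached e N k w : 0 < e ->
  (exists2 j, (j <= k)%N & e <= `|\sum_(N <= i < N + j) D i w|) <->
  e <= `|stopped e N k w|.
Proof.
move=> e0; elim: k => [|k [IHk IHk']] /=.
  split; last by rewrite normr0 leNgt e0.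
  by move=> [j]; rewrite leqn0 => /eqP->; rewrite addn0 big_geq// normr0 leNgt e0.
have [es|se] := boolP (e <= `|stopped e N k w|).
  by split => // _; have [j jk ej] := IHk' es; exists j => //; exact: leqW.
have below : forall j, (j <= k)%N -> ~~ (e <= `|\sum_(N <= i < N + j) D i w|).
  by move=> j jk; apply: contra se => ej; apply: IHk; exists j.
have -> : stopped e N k w + D (N + k) w = \sum_(N <= i < N + k.+1) D i w.
  rewrite addnS big_nat_recr ?leq_addr//=; congr (_ + _).
  elim: {IHk IHk' se} k below => [|k IHk] below; first by rewrite addn0 big_geq.
  rewrite /= IHk; last by move=> j jk; apply: below; exact: leqW.
  by rewrite (negbTE (below k _))// addnS big_nat_recr ?leq_addr.
split=> [[j]|ek]; last by exists k.+1.
by rewrite leq_eqVlt => /predU1P[->//|]; rewrite ltnS => /below/negP.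
Qed.

Lemma D_sq_integrable n :
  P.-integrable [set: Omega] (EFin \o (fun w => D n w ^+ 2)).
Proof.
exact: (integrable_sq_of_sum (fun k => H_discrete k.+1) D_adapted D_sq_sum).
Qed.

Lemma D_integrable n : P.-integrable [set: Omega] (EFin \o D n).
Proof.
exact: (integrable_of_sq (H_discrete n.+1) (@D_adapted n) (D_sq_integrable n)).
Qed.

(** Expanding the square of one step, the cross term is [g * D n] with [g]
    determined by the past, so its integral vanishes; the remaining term is at
    most the square of the increment. *)
Lemma stopped_second_moment e N k : 0 < e ->
  P.-integrable [set: Omega] (EFin \o (fun w => stopped e N k w ^+ 2)) /\
  (\int[P]_w (stopped e N k w ^+ 2)%:E <=
    \sum_(N <= i < N + k) \int[P]_w (D i w ^+ 2)%:E)%E.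
Proof.
move=> e0; elim: k => [|k [intS leS]].
  rewrite addn0 big_geq// /= expr0n/=; split.
    exact: integrable0.
  by rewrite integral0.
pose n := (N + k)%N.
pose g w := if e <= `|stopped e N k w| then 0 else 2 * stopped e N k w.
pose q w := if e <= `|stopped e N k w| then 0 else D n w ^+ 2.
have g_adapted : determined (H n) g.
  by move=> w w' /stopped_adapted Hw; rewrite /g Hw.
have mE (f : Omega -> R) : determined (H n.+1) f ->
    measurable_fun [set: Omega] (EFin \o f).
  move=> df; apply: (determined_measurable_fun (H_discrete n.+1)) => w w'.
  by move=> /df /= ->.
have intq : P.-integrable [set: Omega] (EFin \o q).
  apply: le_integrable (D_sq_integrable n) => //.
    apply: mE => w w' Hw; rewrite /q (stopped_adapted _ (H_nested Hw)).
    by rewrite (D_adapted Hw).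
  move=> w _ /=; rewrite lee_fin /q; case: ifP => // _.
  by rewrite normr0.
have intgD : P.-integrable [set: Omega] (EFin \o (fun w => g w * D n w)).
  apply: le_integrable (integrableZl measurableT (2 * e) (D_integrable n)) => //.
    apply: mE => w w' Hw; rewrite (g_adapted w w' (H_nested Hw)).
    by rewrite (D_adapted Hw).
  move=> w _ /=; rewrite lee_fin !normrM ler_wpM2r//.
  rewrite /g; case: ifP => [_|/negbT]; first by rewrite normr0 mulr_ge0// normr_ge0.
  by rewrite -ltNge normrM => /ltW h; rewrite ler_wpM2l// (le_trans h)// ler_norm.
pose f1 := EFin \o (fun w => stopped e N k w ^+ 2).
pose f2 := EFin \o q.
pose f3 := EFin \o (fun w => g w * D n w).
have SE : EFin \o (fun w => stopped e N k.+1 w ^+ 2) = (f1 \+ f2 \+ f3)%E.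
  apply/funext => w /=; rewrite -!EFinD /q /g; congr (_%:E).
  by case: ifP => _; rewrite -/n; ring.
have intSq := integrableD measurableT intS intq.
split; first by rewrite SE; exact: integrableD.
have -> : (\int[P]_w (stopped e N k.+1 w ^+ 2)%:E =
    \int[P]_w ((f1 \+ f2) w + f3 w))%E.
  by apply: eq_integral => w _; have := congr1 (@^~ w) SE.
rewrite integralD// [X in (_ + X)%E](_ : _ = 0)%E; last first.
  apply: (integral_mul_determined (H_discrete n)) => //.
  exact: D_integrable.
rewrite adde0 integralD// addnS big_nat_recr ?leq_addr//=.
apply: leeD => //; apply: ge0_le_integral => //.
- by move=> w _; rewrite lee_fin /q; case: ifP => // _; exact: sqr_ge0.
- by case/integrableP : intq.
- by case/integrableP : (D_sq_integrable n).
- by move=> w _; rewrite lee_fin /q; case: ifP => // _; exact: sqr_ge0.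
Qed.

Lemma exceedE e N : 0 < e ->
  [set w | exists k, e <= `|\sum_(N <= i < N + k) D i w|] =
  \bigcup_k [set w | e <= `|stopped e N k w|].
Proof.
move=> e0.
apply/seteqP; split => [w [k ek]|w [k _ /(stopped_reached _ _ _ e0)[j _ ej]]].
  by exists k => //; apply/(stopped_reached _ _ _ e0); exists k.
by exists j.
Qed.

Lemma measurable_stopped_ge e N k :
  measurable [set w | e <= `|stopped e N k w|].
Proof.
exact: (determined_preimage [set x : R | e <= `|x|] (H_discrete (N + k))
  (@stopped_adapted e N k)).
Qed.

(** Kolmogorov's inequality, by Chebyshev's bound for the stopped process and
    continuity of the measure along an increasing union. *)
Lemma maximal_inequality e N : 0 < e ->
  ((e ^+ 2)%:E * P [set w | exists k, (e <= `|\sum_(N <= i < N + k) D i w|)%R]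
   <= \sum_(N <= i <oo) \int[P]_w (D i w ^+ 2)%:E)%E.
Proof.
move=> e0; rewrite exceedE//; pose A k := [set w | e <= `|stopped e N k w|].
rewrite -[X in P X]/(\bigcup_k A k).
have mA k : measurable (A k) by exact: measurable_stopped_ge.
have A_nd : {homo A : n m / (n <= m)%N >-> (n <= m)%O}.
  move=> n m nm; apply/subsetPset => w /(stopped_reached _ _ _ e0)[j jn ej].
  by apply/(stopped_reached _ _ _ e0); exists j => //; exact: leq_trans nm.
have cvgA := nondecreasing_cvg_mu (mu := P) mA
  (bigcup_measurable (fun k _ => mA k)) A_nd.
have bound k : ((e ^+ 2)%:E * P (A k) <=
    \sum_(N <= i <oo) \int[P]_w (D i w ^+ 2)%:E)%E.
  have [intS leS] := stopped_second_moment N k e0.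
  apply: (@le_trans _ _ (\int[P]_w (stopped e N k w ^+ 2)%:E)%E); last first.
    apply: (le_trans leS); apply: nneseries_lim_ge => i _ _.
    by apply: integral_ge0 => w _; rewrite lee_fin sqr_ge0.
  have mS : measurable_fun [set: Omega] (EFin \o (fun w => stopped e N k w ^+ 2)).
    by case/integrableP : intS.
  rewrite -integral_cst//.
  apply: (@le_trans _ _ (\int[P]_(w in A k) (stopped e N k w ^+ 2)%:E)%E).
    apply: ge0_le_integral => //.
    - by move=> w _; rewrite lee_fin sqr_ge0.
    - exact: measurable_funS mS.
    - move=> w /= Aw; rewrite lee_fin -[leRHS]ger0_norm ?sqr_ge0// normrX.
      by rewrite ler_pXn2r// nnegrE ltW.
  by apply: ge0_subset_integral => // w _; rewrite lee_fin sqr_ge0.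
have lim := cvgeZl (y := (e ^+ 2)%:E) isT cvgA.
rewrite -(cvg_lim _ lim)//; apply: lime_le; first exact: cvgP lim.
by apply: nearW => k; exact: bound.
Qed.

(** Outside a null set, for every [j] some tail of the series stays within
    1 / (j + 1) of its starting point, because the bound of
    [maximal_inequality] tends to 0 with [N]; such a series is Cauchy. *)
Lemma martingale_cvg : {ae P, forall w, cvgn (series (D ^~ w))}.
Proof.
pose E j N := [set w | exists k,
  j.+1%:R^-1 <= `|\sum_(N <= i < N + k) D i w|].
have mE j N : measurable (E j N).
  rewrite /E exceedE ?invr_gt0//; apply: bigcup_measurable => k _.
  exact: measurable_stopped_ge.
have mI j : measurable (\bigcap_N E j N) by exact: bigcap_measurable.
have sq0 n : (0 <= \int[P]_w (D n w ^+ 2)%:E)%E.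
  by apply: integral_ge0 => w _; rewrite lee_fin sqr_ge0.
have I0 j : P (\bigcap_N E j N) = 0%E.
  have e0 : 0 < (j.+1%:R^-1 : R) by rewrite invr_gt0.
  have tail := @nneseries_tail_cvg _ _ xpredT D_sq_sum (fun k _ => sq0 k).
  have : ((j.+1%:R^-1 ^+ 2)%:E * P (\bigcap_N E j N) <= 0)%E.
    rewrite -(cvg_lim _ tail)//; apply: lime_ge; first exact: cvgP tail.
    apply: nearW => N; apply: le_trans (maximal_inequality N e0).
    apply: lee_wpmul2l; first by rewrite lee_fin exprn_ge0// ltW.
    by apply: le_measure; rewrite ?inE//; [exact: (mE j N)|move=> w; exact].
  rewrite pmule_rle0 ?lte_fin ?exprn_gt0// => h.
  by apply/eqP; rewrite eq_le h measure_ge0.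
exists (\bigcup_j \bigcap_N E j N); split.
- exact: bigcup_measurable.
- apply/negligibleP; first exact: bigcup_measurable.
  apply: negligible_bigcup => j; exists (\bigcap_N E j N).
  by split; [exact: mI|exact: I0|].
move=> w /= ncv; apply: contrapT => nE; apply: ncv.
apply/cauchy_cvgP/cauchy_exP => e e0.
have [j je] : exists j : nat, (j.+1%:R^-1 : R) < e.
  exists (Num.truncn e^-1); rewrite invf_plt ?posrE//.
  exact: truncnS_gt.
have [N nEN] : exists N, ~ E j N w.
  apply: contrapT => h; apply: nE; exists j => // N _.
  by apply: contrapT => hN; apply: h; exists N.
exists (series (D ^~ w) N); exists N => // n /= Nn.
rewrite -ball_normE/= distrC sub_series_geq// -(subnKC Nn).
rewrite ltNge; apply/negP => he; apply: nEN; exists (n - N)%N.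
exact: le_trans (ltW je) he.
Qed.

End martingale_convergence.

(** * Growth of the number of balls of one color *)

(** [H n] encodes the past up to time [n], [U n] and [T n] are the number of balls
    of the color under study and of all balls, [z n] is the number of balls of
    that color in the next sample, each of which brings [A n] new ones. The
    equality [z_mean] on atoms is the conditional mean of the sample. *)
Section one_color.
Context {d : measure_display} {Omega : measurableType d} {R : realType}.
Variables (P : probability Omega R) (m : nat) (mu : R).
Variables (H U T A z : nat -> Omega -> nat).
Hypothesis H_discrete : forall n, discrete (H n).
Hypothesis H_nested : forall n, determined (H n.+1) (H n).
Hypothesis U_adapted : forall n, determined (H n) (U n).
Hypothesis T_adapted : forall n, determined (H n) (T n).
Hypothesis A_discrete : forall n, discrete (A n).
Hypothesis z_discrete : forall n, discrete (z n).
Hypothesis A_gt0 : forall n w, (0 < A n w)%N.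
Hypothesis z_le : forall n w, (z n w <= m)%N.
Hypothesis U_rec : forall n w, U n.+1 w = (U n w + A n w * z n w)%N.
Hypothesis T_gt0 : forall n w, (0 < T n w)%N.
Hypothesis A_indep : forall n a k j,
  P ((H n @^-1` [set a] `&` z n @^-1` [set k]) `&` A n @^-1` [set j]) =
  (P (H n @^-1` [set a] `&` z n @^-1` [set k]) * P (A n @^-1` [set j]))%E.
Hypothesis A_ident : forall n j,
  P (A n @^-1` [set j]) = P (A 0%N @^-1` [set j]).
Hypothesis A_mean : (\int[P]_w (A 0%N w)%:R%:E = mu%:E)%E.
Hypothesis A_sq : (\int[P]_w ((A 0%N w)%:R ^+ 2)%:E < +oo)%E.
Hypothesis z_mean : forall n a,
  (\int[P]_(w in H n @^-1` [set a]) (z n w)%:R%:E =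
   \int[P]_(w in H n @^-1` [set a]) (m%:R * (U n w)%:R / (T n w)%:R)%:E)%E.

Lemma mu_ge0 : 0 <= mu.
Proof. by rewrite -lee_fin -A_mean integral_ge0// => w _; rewrite lee_fin. Qed.

(** When [U n] vanishes, the conditional mean m U_n / T_n of the sample vanishes
    too, so the nonnegative variable [z n] is almost surely zero there. *)
Lemma absorbed_at_zero : (forall w, U 0%N w = 0%N) ->
  {ae P, forall w, forall n, U n w = 0%N}.
Proof.
move=> U0; pose f n w : R := if U n w == 0%N then (z n w)%:R else 0.
have mz n (D : set Omega) : measurable_fun D (fun w => (z n w)%:R%:E : \bar R).
  by apply: (determined_measurable_fun (z_discrete n)) => w w' ->.
have mf n (D : set Omega) : measurable_fun D (fun w => (f n w)%:E).
  have -> : (fun w => (f n w)%:E) = (fun w => (if U n w == 0%N then 1 else 0)%:E * (z n w)%:R%:E)%E.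
    by apply/funext => w; rewrite /f; case: ifP => _; rewrite ?mul1e ?mul0e.
  apply: emeasurable_funM => //.
  by apply: (determined_measurable_fun (H_discrete n)) => w w' /U_adapted ->.
have f0 n w : (0 <= (f n w)%:E)%E by rewrite lee_fin /f; case: ifP.
have If0 n : (\int[P]_w (f n w)%:E = 0)%E.
  rewrite (ge0_integral_atoms _ (H_discrete n))//; apply: eseries0 => a _ _.
  have [->|/set0P[w0 /= Hw0]] := eqVneq (H n @^-1` [set a]) set0.
    by rewrite integral_set0.
  have UE w : H n w = a -> U n w = U n w0.
    by move=> Hw; apply: U_adapted; rewrite Hw.
  have [U0w|U0w] := eqVneq (U n w0) 0%N.
    transitivity (\int[P]_(w in H n @^-1` [set a]) (z n w)%:R%:E)%E.
      by apply: eq_integral => w; rewrite inE/= /f => /UE ->; rewrite U0w.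
    rewrite z_mean integral0_eq// => w /= /UE ->.
    by rewrite U0w mulr0 mul0r.
  by rewrite integral0_eq// => w /= /UE; rewrite /f => ->; rewrite (negbTE U0w).
have step n : {ae P, forall w, U n w = 0%N -> z n w = 0%N}.
  have : ae_eq P setT (fun w => (f n w)%:E) (cst 0).
    apply/ae_eq_integral_abs => //; rewrite -[RHS](If0 n).
    by apply: eq_integral => w _; rewrite gee0_abs.
  apply: filterS => w /(_ I)/= h Un0; move: h; rewrite /f Un0 eqxx => -[] /eqP.
  by rewrite pnatr_eq0 => /eqP.
have /ae_foralln := step; apply: filterS => w zw.
by elim=> [|n IHn]; rewrite ?U0// U_rec IHn zw// muln0.
Qed.

Section positive_start.
Hypothesis U0_gt0 : forall w, (0 < U 0%N w)%N.

(* Relative increment of the color, its conditional mean, and the part of the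
   relative increment that comes from the sample. *)
Let r n w : R := ((U n.+1 w)%:R - (U n w)%:R) / (U n w)%:R.
Let v n w : R := m%:R * mu / (T n w)%:R.
Let q n w : R := (z n w)%:R / (U n w)%:R.

Lemma U_gt0 n w : (0 < U n w)%N.
Proof. by elim: n => // n IHn; rewrite U_rec addn_gt0 IHn. Qed.

Let rE n w : r n w = q n w * (A n w)%:R.
Proof. by rewrite /r /q U_rec natrD natrM; ring. Qed.

(** A bound on every path. From U_{n+1} >= U_n + z_n and z_n <= m,
    1 / U_n - 1 / U_{n+1} >= z_n / (U_n (U_n + z_n)) and
    U_n + z_n <= (m + 1) U_n, so that (z_n / U_n)^2 <= m z_n / U_n^2 is at most
    m (m + 1) times a telescoping difference. *)
Lemma draw_sq_sum_le w n :
  \sum_(0 <= k < n) (q k w) ^+ 2 <= m%:R * m.+1%:R.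
Proof.
have Ugt k : 0 < (U k w)%:R :> R by rewrite ltr0n U_gt0.
suff h : \sum_(0 <= k < n) (q k w) ^+ 2 <=
    m%:R * m.+1%:R * ((U 0%N w)%:R^-1 - (U n w)%:R^-1).
  apply: (le_trans h); rewrite ler_piMr// ?mulr_ge0//.
  rewrite lerBlDr (le_trans (_ : _ <= 1))// ?lerDl ?invr_ge0//.
  by rewrite invf_le1// ler1n U_gt0.
elim: n => [|n IHn]; first by rewrite big_geq// subrr mulr0.
rewrite big_nat_recr//= (le_trans (lerD IHn (lexx _)))//.
rewrite -lerBrDl -mulrBr
  [X in _ <= _ * X](_ : _ = (U n w)%:R^-1 - (U n.+1 w)%:R^-1); last ring.
rewrite /q; set a := (U n w)%:R : R; set y := (z n w)%:R : R.
have a1 : 1 <= a by rewrite ler1n U_gt0.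
have y0 : 0 <= y by [].
have ym : y <= m%:R by rewrite ler_nat.
have aS : a + y <= (U n.+1 w)%:R.
  by rewrite U_rec -natrD ler_nat leq_add2l leq_pmull.
have ay0 : 0 < a + y by lra.
apply: (@le_trans _ _ (m%:R * m.+1%:R * (a^-1 - (a + y)^-1))); last first.
  rewrite ler_wpM2l ?mulr_ge0// lerD2l lerN2 lef_pV2// posrE//.
(* The remainder is nonnegative because y <= m and 1 <= a. *)
have -> : m%:R * m.+1%:R * (a^-1 - (a + y)^-1) =
    (y / a) ^+ 2 + y * (m%:R * m.+1%:R * a - y * (a + y)) / (a ^+ 2 * (a + y)).
  by field; rewrite !gt_eqF// (lt_le_trans ltr01).
rewrite lerDl divr_ge0 ?mulr_ge0 ?exprn_ge0//; try lra.
rewrite -natr1 subr_ge0.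
have : y * (a + y) <= m%:R * (a + m%:R) by apply: ler_pM => //; lra.
have : 0 <= (m%:R : R) by [].
move: (m%:R : R) => M M0; nra.
Qed.

(* The past together with the next sample: [A n] is independent of this pair. *)
Let joint n w : nat := choice.pickle (H n w, z n w).

Let jointE n w w' : joint n w = joint n w' -> H n w = H n w' /\ z n w = z n w'.
Proof. by move=> /(pcan_inj choice.pickleK) [-> ->]. Qed.

Let joint_atom n w0 : joint n @^-1` [set joint n w0] =
  H n @^-1` [set H n w0] `&` z n @^-1` [set z n w0].
Proof.
apply/seteqP; split => [w /= /jointE[-> ->]//|w [/= Hw zw]].
by rewrite /joint/= Hw zw.
Qed.

Let joint_discrete n : discrete (joint n).
Proof.
move=> b; have [->|/set0P[w0 /= <-]] := eqVneq (joint n @^-1` [set b]) set0.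
  exact: measurable0.
by rewrite joint_atom; apply: measurableI; [exact: H_discrete|exact: z_discrete].
Qed.

Let joint_indep n b j : P (joint n @^-1` [set b] `&` A n @^-1` [set j]) =
  (P (joint n @^-1` [set b]) * P (A n @^-1` [set j]))%E.
Proof.
have [->|/set0P[w0 /= <-]] := eqVneq (joint n @^-1` [set b]) set0.
  by rewrite set0I measure0 mul0e.
by rewrite joint_atom A_indep.
Qed.

Let A_integral (h : nat -> R) n : (forall j, 0 <= h j) ->
  (\int[P]_w (h (A n w))%:E = \int[P]_w (h (A 0%N w))%:E)%E.
Proof. by move=> h0; apply: eq_integral_nat_comp => // j; exact: A_ident. Qed.

Let q_joint n : determined (joint n) (q n).
Proof. by move=> w w' /jointE[/U_adapted Uw zw]; rewrite /q Uw zw. Qed.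

Let r_adapted n : determined (H n.+1) (r n).
Proof.
move=> w w' Hw; rewrite /r (U_adapted Hw).
by rewrite (U_adapted (H_nested Hw)).
Qed.

Let v_adapted n : determined (H n) (v n).
Proof. by move=> w w' /T_adapted Tw; rewrite /v Tw. Qed.

(** Independence turns the second moment of r_n into E A^2 times that of the
    sampled part, and the sum of the latter is bounded on every path. *)
Lemma increments_sq_sum : (\sum_(n <oo) \int[P]_w ((r n w) ^+ 2)%:E < +oo)%E.
Proof.
have A20 : (0 <= \int[P]_w ((A 0%N w)%:R ^+ 2)%:E)%E.
  by apply: integral_ge0 => w _; rewrite lee_fin sqr_ge0.
have A2f : (\int[P]_w ((A 0%N w)%:R ^+ 2)%:E)%E \is a fin_num.
  by rewrite ge0_fin_numE.
have mq n : measurable_fun [set: Omega] (fun w => (q n w ^+ 2)%:E).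
  by apply: (determined_measurable_fun (joint_discrete n)) => w w' /q_joint ->.
have E n : (\int[P]_w ((r n w) ^+ 2)%:E =
    (fine (\int[P]_w ((A 0%N w)%:R ^+ 2)%:E))%:E *
    \int[P]_w ((q n w) ^+ 2)%:E)%E.
  rewrite fineK// -(A_integral (h := fun j => j%:R ^+ 2) n); last by move=> j; exact: sqr_ge0.
  rewrite -(integral_mul_indep (N := joint n) (f := fun w => q n w ^+ 2)
    (h := fun j => j%:R ^+ 2))//.
  - by apply: eq_integral => w _; rewrite rE exprMn.
  - by move=> w w' /q_joint ->.
  - by move=> w; exact: sqr_ge0.
rewrite (eq_eseriesr (fun n _ => E n)) nneseriesZl; last first.
  by move=> n _; apply: integral_ge0 => w _; rewrite lee_fin sqr_ge0.
rewrite -integral_nneseries//; last by move=> n w _; rewrite lee_fin sqr_ge0.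
apply: lte_mul_pinfty => //; first by rewrite lee_fin fine_ge0.
apply: (@le_lt_trans _ _ (\int[P]_w (m%:R * m.+1%:R)%:E)%E).
  apply: ge0_le_integral => //.
  - by move=> w _; apply: nneseries_ge0 => n _ _; rewrite lee_fin sqr_ge0.
  - apply: ge0_emeasurable_sum => // n w _ _.
    by rewrite lee_fin sqr_ge0.
  - move=> w _; apply: lime_le.
      by apply: is_cvg_nneseries => n _ _; rewrite lee_fin sqr_ge0.
    by apply: nearW => n; rewrite sumEFin lee_fin draw_sq_sum_le.
by rewrite integral_cst// [X in (_ * X)%E](probability_setT P) mule1 ltry.
Qed.


Let r_sq_integrable n :
  P.-integrable [set: Omega] (EFin \o (fun w => r n w ^+ 2)).
Proof. exact: (integrable_sq_of_sum (fun k => H_discrete k.+1) r_adapted increments_sq_sum). Qed.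

Let r_integrable n : P.-integrable [set: Omega] (EFin \o r n).
Proof.
apply: (integrable_of_sq (H_discrete n.+1) (@r_adapted n)).
exact: r_sq_integrable.
Qed.

Let v_bound n w : 0 <= v n w <= m%:R * mu.
Proof.
have T1 : 1 <= (T n w)%:R :> R by rewrite ler1n.
have mmu : 0 <= m%:R * mu by rewrite mulr_ge0 ?mu_ge0.
rewrite /v divr_ge0//= ler_pdivrMr ?(lt_le_trans ltr01)//.
by rewrite ler_peMr.
Qed.

Let v_integrable n : P.-integrable [set: Omega] (EFin \o v n).
Proof.
apply: le_integrable (finite_measure_integrable_cst P (m%:R * mu) measurableT) => //.
  by apply: (determined_measurable_fun (H_discrete n)) => w w' /v_adapted /= ->.
move=> w _ /=; have /andP[v0 v1] := v_bound n w.
by rewrite lee_fin !ger0_norm// (le_trans v0).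
Qed.

Let centered_integrable n :
  P.-integrable [set: Omega] (EFin \o (fun w => r n w - v n w)).
Proof.
by have := integrableB measurableT (r_integrable n) (v_integrable n).
Qed.

(** On an atom of the past, [U n] and [T n] are constants, and independence
    replaces [A n] by its mean. *)
Lemma increments_centered n a :
  (\int[P]_(w in H n @^-1` [set a]) (r n w - v n w)%:E = 0)%E.
Proof.
have [->|/set0P[w0 /= Hw0]] := eqVneq (H n @^-1` [set a]) set0.
  by rewrite integral_set0.
have Ha : measurable (H n @^-1` [set a]) by exact: H_discrete.
have UE w : H n w = a -> U n w = U n w0.
  by move=> Hw; apply: U_adapted; rewrite Hw.
have TE w : H n w = a -> T n w = T n w0.
  by move=> Hw; apply: T_adapted; rewrite Hw.
have mz (D : set Omega) : measurable_fun D (fun w => (z n w)%:R%:E : \bar R).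
  by apply: (determined_measurable_fun (z_discrete n)) => w w' ->.
rewrite (integralB Ha (f1 := EFin \o r n) (f2 := EFin \o v n)); last 2 first.
- exact: integrableS (r_integrable n).
- exact: integrableS (v_integrable n).
suff -> : (\int[P]_(w in H n @^-1` [set a]) (EFin \o r n) w =
    \int[P]_(w in H n @^-1` [set a]) (EFin \o v n) w)%E.
  by rewrite subee// integrable_fin_num//; exact: integrableS (v_integrable n).
have atomE (g : Omega -> R) : (forall w, H n w = a -> g w = g w0) ->
    (\int[P]_(w in H n @^-1` [set a]) (g w)%:E =
     (g w0)%:E * P (H n @^-1` [set a]))%E.
  move=> ga; rewrite -integral_cst//; apply: eq_integral => w.
  by rewrite inE/= => /ga ->.
pose f w := if H n w == a then q n w else 0.
have fE (g : Omega -> R) : (\int[P]_(w in H n @^-1` [set a]) (g w)%:E =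
    \int[P]_w (if H n w == a then g w else 0)%:E)%E.
  rewrite integral_mkcond; apply: eq_integral => w _; rewrite patchE.
  case: ifPn => [|]; first by rewrite inE/= => ->; rewrite eqxx.
  by rewrite notin_setE/= => /eqP/negbTE ->.
rewrite fE (_ : (\int[P]_w _ = \int[P]_w (f w * (A n w)%:R)%:E)%E); last first.
  by apply: eq_integral => w _; rewrite /f; case: ifP; rewrite ?mul0r// rE.
rewrite (integral_mul_indep (N := joint n) (f := f) (h := fun j => j%:R))//.
- rewrite (A_integral (h := fun j => j%:R))// A_mean -fE.
  transitivity (mu%:E * \int[P]_(w in H n @^-1` [set a])
      ((U n w0)%:R^-1%:E * (z n w)%:R%:E))%E.
    congr (_ * _)%E; apply: eq_integral => w; rewrite inE/= => /UE Uw.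
    by rewrite /q Uw -EFinM mulrC.
  rewrite ge0_integralZl// z_mean.
  rewrite (atomE (fun w => m%:R * (U n w)%:R / (T n w)%:R)); last first.
    by move=> w Hw; rewrite (UE w)// (TE w).
  rewrite (atomE (v n)); last by move=> w Hw; rewrite /v (TE w).
  rewrite !muleA -!EFinM; congr (_%:E * _)%E.
  by rewrite /v; field; rewrite !pnatr_eq0 -!lt0n T_gt0 U_gt0.
- by move=> w w' /[dup] /q_joint qw /jointE[Hw _]; rewrite /f Hw qw.
- by move=> w; rewrite /f; case: ifP => //; rewrite /q divr_ge0.
Qed.

(** Centering does not increase the second moment: v_n is determined by the past,
    hence orthogonal to r_n - v_n, and
    (r_n - v_n)^2 <= r_n^2 - 2 v_n (r_n - v_n). *)
Lemma centered_sq_sum :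
  (\sum_(n <oo) \int[P]_w ((r n w - v n w) ^+ 2)%:E < +oo)%E.
Proof.
apply: le_lt_trans increments_sq_sum; apply: lee_nneseries => n _.
  by move=> _; apply: integral_ge0 => w _; rewrite lee_fin sqr_ge0.
pose g w := - 2 * v n w.
have dg : determined (H n) g by move=> w w' /v_adapted; rewrite /g => ->.
have mE (f : Omega -> R) : determined (H n.+1) f ->
    measurable_fun [set: Omega] (EFin \o f).
  move=> df; apply: (determined_measurable_fun (H_discrete n.+1)) => w w'.
  by move=> /df /= ->.
have dS : determined (H n.+1) (fun w => r n w - v n w).
  by move=> w w' Hw; rewrite (r_adapted Hw) (v_adapted (H_nested Hw)).
have intg : P.-integrable [set: Omega] (EFin \o (fun w => g w * (r n w - v n w))).
  apply: le_integrable (integrableZl measurableT (2 * (m%:R * mu))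
    (centered_integrable n)) => //.
    by apply: mE => w w' Hw; rewrite (dS w w')// (dg w w')//; exact: H_nested.
  move=> w _ /=; rewrite lee_fin !normrM ler_wpM2r// /g.
  have /andP[v0 v1] := v_bound n w.
  rewrite normrN ler_wpM2l// -!normrM (ger0_norm v0).
  by rewrite (ger0_norm (le_trans v0 v1)).
have -> : (\int[P]_w (r n w ^+ 2)%:E = \int[P]_w ((EFin \o (fun w => (r n w ^+ 2)%R)) w +
    (EFin \o (fun w => (g w * (r n w - v n w))%R)) w))%E.
  rewrite integralD//.
  rewrite [X in (_ + X)%E](_ : _ = 0)%E ?adde0//.
  apply: (integral_mul_determined (H_discrete n)) => //.
  exact: increments_centered.
apply: ge0_le_integral => //.
- by move=> w _; rewrite lee_fin sqr_ge0.
- by apply: mE => w w' Hw; rewrite (dS w w').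
- apply: emeasurable_funD; last by case/integrableP : intg.
  by case/integrableP : (r_sq_integrable n).
- move=> w _ /=; rewrite -EFinD lee_fin /g -subr_ge0.
  by rewrite (_ : _ - _ = v n w ^+ 2) ?sqr_ge0//; ring.
Qed.

(** The two almost sure convergences required by [cvg_ratio_expR_series]. *)
Lemma ae_growth : {ae P, forall w, exists2 l : R, 0 < l &
  (U n w)%:R / expR (m%:R * mu * series (fun k => (T k w)%:R^-1) n)
    @[n --> \oo] --> l}.
Proof.
have dS n : determined (H n.+1) (fun w => r n w - v n w).
  by move=> w w' Hw; rewrite (r_adapted Hw) (v_adapted (H_nested Hw)).
have mart := martingale_cvg H_discrete H_nested dS increments_centered
  centered_sq_sum.
have mr n : measurable_fun [set: Omega] (fun w => ((r n w) ^+ 2)%:E).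
  by apply: (determined_measurable_fun (H_discrete n.+1)) => w w' /r_adapted ->.
have sq : {ae P, forall w, cvgn (series (fun n => r n w ^+ 2))}.
  have int : P.-integrable [set: Omega]
      (fun w => \sum_(n <oo) ((r n w) ^+ 2)%:E)%E.
    apply/integrableP; split.
      apply: ge0_emeasurable_sum => // n w _ _.
      by rewrite lee_fin sqr_ge0.
    rewrite (eq_integral (fun w => \sum_(n <oo) ((r n w) ^+ 2)%:E)%E); last first.
      move=> w _; rewrite gee0_abs// nneseries_ge0// => n _ _.
      by rewrite lee_fin sqr_ge0.
    rewrite integral_nneseries//; last by move=> n w _; rewrite lee_fin sqr_ge0.
    exact: increments_sq_sum.
  have := integrable_ae measurableT int; apply: filterS => w /(_ I) fin.
  apply: nondecreasing_is_cvgn.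
    by apply: nondecreasing_series => n _ _; exact: sqr_ge0.
  exists (fine (\sum_(n <oo) ((r n w) ^+ 2)%:E)%E) => _ [n _ <-].
  rewrite -lee_fin fineK// seriesEnat/= -sumEFin.
  by apply: nneseries_lim_ge => k _ _; rewrite lee_fin sqr_ge0.
apply: filterS2 mart sq => w mw sw.
have [] := @cvg_ratio_expR_series R (fun n => (U n w)%:R) (fun n => v n w) _ _ sw mw.
- by move=> n; rewrite ltr0n U_gt0.
- apply: homo_leq => [//|x y z'|n]; [exact: le_trans|].
  by rewrite U_rec ler_nat leq_addr.
move=> l l0 Ul; exists l => //.
rewrite (_ : (fun n => _ / expR (m%:R * mu * _)) =
  (fun n => (U n w)%:R / expR (series (fun k => v k w) n)))//.
apply/funext => n; congr (_ / expR _).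
by rewrite !seriesEnat/= mulr_sumr.
Qed.

End positive_start.
End one_color.

(** * Limits of random variables *)

Section limit_random_variable.
Context {d : measure_display} {Omega : measurableType d} {R : realType}.
Variable P : probability Omega R.

(** The exponential of an upper limit of logarithms is measurable and positive
    at every point, including those where the sequence does not converge. *)
Lemma positive_limit_rv (f : nat -> Omega -> R) :
  (forall n, measurable_fun [set: Omega] (f n)) ->
  exists Z : {RV P >-> R}, (forall w, 0 < Z w) /\
    forall w (l : R), 0 < l -> f n w @[n --> \oo] --> l -> Z w = l.
Proof.
move=> mf.
pose g w := limn_esup (fun n => (ln (f n w))%:E).
have mZ : measurable_fun [set: Omega] (fun w => expR (fine (g w))).
  apply: measurableT_comp => //; apply: measurableT_comp => //.
  apply: measurable_fun_limn_esup => n; apply/measurable_EFinP.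
  by apply: measurableT_comp => //; exact: measurable_ln.
exists (mfun_Sub (mem_set mZ)); split => [w|w l l0 fl] /=.
  exact: expR_gt0.
have lnl : (ln (f n w))%:E @[n --> \oo] --> (ln l)%:E.
  apply: cvg_EFin; first exact: nearW.
  exact: (continuous_cvg _ (continuous_ln l0) fl).
by rewrite /g is_cvg_limn_esupE ?(cvg_lim _ lnl)//= ?lnK ?posrE//; exact: cvgP lnl.
Qed.

End limit_random_variable.

(** * Mean of the hypergeometric distribution *)

Section hypergeometric.

(** Absorb the factor k by k C(a, k) = a C(a - 1, k - 1), sum with Vandermonde's
    identity, and use (a + b) C(a + b - 1, m - 1) = m C(a + b, m). *)
Lemma hypergeometric_mean_nat (a b m : nat) :
  ((a + b) * \sum_(k < m.+1) k * ('C(a, k) * 'C(b, m - k)) =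
   m * a * 'C(a + b, m))%N.
Proof.
case: m => [|m]; first by rewrite big_ord1 !mul0n muln0.
case: a => [|a].
  rewrite muln0 mul0n big1 ?muln0// => -[[|k] km] _ //=.
  by rewrite bin0n mul0n muln0.
rewrite big_ord_recl/= mul0n add0n.
have -> : (\sum_(i < m.+1) bump 0 i * ('C(a.+1, bump 0 i) * 'C(b, m.+1 - bump 0 i))
    = a.+1 * 'C(a + b, m))%N.
  rewrite -binomial.Vandermonde big_distrr/=; apply: eq_bigr => i _.
  by rewrite /bump/= add1n subSS mulnA -mul_bin_diag/= mulnA.
by rewrite mulnCA (mul_bin_diag (a.+1 + b) m) mulnCA mulnA.
Qed.

Lemma hypergeometric_mean (R : numFieldType) (a b m : nat) : (m <= a + b)%N ->
  (0 < a + b)%N ->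
  \sum_(k < m.+1) k%:R * (('C(a, k) * 'C(b, m - k))%:R / 'C(a + b, m)%:R) =
  m%:R * a%:R / (a + b)%:R :> R.
Proof.
move=> mab ab0; have C0 : 'C(a + b, m)%:R != 0 :> R.
  by rewrite pnatr_eq0 -lt0n bin_gt0.
have ab0' : (a + b)%:R != 0 :> R by rewrite pnatr_eq0 -lt0n.
under eq_bigr do rewrite mulrA -natrM.
rewrite -mulr_suml -natr_sum; apply: (mulIf C0); rewrite divfK//.
apply: (mulfI ab0'); rewrite -[LHS]natrM hypergeometric_mean_nat !natrM.
by rewrite mulrA mulrCA mulfV// mulr1.
Qed.

Lemma hypergeometric_mean_compl (R : numFieldType) (a b m : nat) :
  (m <= a + b)%N -> (0 < a + b)%N ->
  \sum_(k < m.+1) (m - k)%:R * (('C(a, k) * 'C(b, m - k))%:R / 'C(a + b, m)%:R) =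
  m%:R * b%:R / (a + b)%:R :> R.
Proof.
move=> mab ab0; rewrite addnC -hypergeometric_mean ?(addnC b)//.
rewrite (reindex_inj rev_ord_inj)/=; apply: eq_bigr => k _.
by rewrite subSS subKn ?(mulnC 'C(a, _))// -ltnS.
Qed.

End hypergeometric.

(** * The urn and its history *)

Section urn_history.
Context {d : measure_display} {Omega : measurableType d} {R : realType}.
Variables (P : probability Omega R) (m : nat).
Variables (X Y xi : nat -> {RV P >-> nat}).
Variables (w0 b0 : nat) (W B : nat -> Omega -> nat).
Hypothesis urn : diagonal_urn m X Y xi w0 b0 W B.
Hypothesis urn_start : (m <= w0 + b0)%N.
Hypothesis m_gt0 : (0 < m)%N.

Lemma discrete_rv (Z : {RV P >-> nat}) : discrete Z.
Proof. by move=> a; rewrite -[_ @^-1` _]setTI; exact: measurable_funP. Qed.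

Definition draw k w : nat * nat * nat :=
  (xi k w, X k w * xi k w, Y k w * (m - xi k w))%N.

(** The first [n] draws encoded as one natural number. Its atoms belong to
    [draws_sigma], so the conditional law of the sample can be read on them. *)
Definition history n w : nat :=
  choice.pickle (mkseq (fun k => draw k.+1 w) n).

Lemma historyP n w w' : history n w = history n w' <->
  forall k, (k < n)%N -> draw k.+1 w = draw k.+1 w'.
Proof.
split=> [/(pcan_inj choice.pickleK) h k kn|h].
  have /(congr1 (fun s => nth (0, 0, 0)%N s k)) := h.
  by rewrite !nth_mkseq.
by rewrite /history; congr choice.pickle; apply/eq_in_map => k; rewrite mem_iota => /h.
Qed.

Lemma history_nested n : determined (history n.+1) (history n).
Proof. by move=> w w' /historyP h; apply/historyP => k kn; apply: h; exact: leqW. Qed.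

Lemma draws_sigma_history n a : draws_sigma m X Y xi n (history n @^-1` [set a]).
Proof.
rewrite /draws_sigma; set G := [set A | _].
suff : @measurable _ (g_sigma_algebraType G) (history n @^-1` [set a]) by [].
have [->|/set0P[w' /= <-]] := eqVneq (history n @^-1` [set a]) set0.
  exact: measurable0.
pose F k : set Omega :=
  if (k < n)%N then draw k.+1 @^-1` [set draw k.+1 w'] else setT.
have -> : history n @^-1` [set history n w'] = \bigcap_k F k.
  apply/seteqP; split => [w /historyP h k _|w h].
    by rewrite /F; case: ifP => // /h.
  by apply/historyP => k kn; have := h k I; rewrite /F kn.
apply: bigcap_measurable => [|k _]; first by exists 0%N.
rewrite /F; case: ifP => [kn|_]; last exact: measurableT.
apply: sub_sigma_algebra.
by exists k.+1, [set draw k.+1 w']; split.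
Qed.

Lemma draws_sigma_measurable n A : draws_sigma m X Y xi n A -> measurable A.
Proof.
apply: smallest_sub; first exact: sigma_algebra_measurable.
move=> _ [k [C [_ ->]]].
pose N w : nat := choice.pickle (xi k w, X k w, Y k w).
have dN : discrete N.
  move=> b; have [->|/set0P[w' /= <-]] := eqVneq (N @^-1` [set b]) set0.
    exact: measurable0.
  have -> : N @^-1` [set N w'] = xi k @^-1` [set xi k w'] `&`
      X k @^-1` [set X k w'] `&` Y k @^-1` [set Y k w'].
    apply/seteqP; split => [w /= /(pcan_inj choice.pickleK)[-> -> ->]//|].
    by move=> w /= [[xiw Xw] Yw]; rewrite /N xiw Xw Yw.
  by do !apply: measurableI; exact: discrete_rv.
apply: (determined_preimage C dN) => w w' /(pcan_inj choice.pickleK).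
by move=> [-> -> ->].
Qed.

Lemma history_discrete n : discrete (history n).
Proof.
move=> a; exact: (@draws_sigma_measurable n _ (@draws_sigma_history n a)).
Qed.

Lemma historyS_draw n w w' : history n.+1 w = history n.+1 w' ->
  draw n.+1 w = draw n.+1 w'.
Proof. by move=> /historyP; exact. Qed.

Lemma W_rec n w : W n.+1 w = (W n w + X n.+1 w * xi n.+1 w)%N.
Proof. exact: (urn_W urn w (isT : (0 < n.+1)%N)). Qed.

Lemma B_rec n w : B n.+1 w = (B n w + Y n.+1 w * (m - xi n.+1 w))%N.
Proof. exact: (urn_B urn w (isT : (0 < n.+1)%N)). Qed.

Lemma W_adapted n : determined (history n) (W n).
Proof.
elim: n => [|n IHn] w w' Hw; first by rewrite !(urn_W0 urn).
rewrite !W_rec (IHn _ _ (history_nested Hw)).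
by have [_ -> _] := historyS_draw Hw.
Qed.

Lemma B_adapted n : determined (history n) (B n).
Proof.
elim: n => [|n IHn] w w' Hw; first by rewrite !(urn_B0 urn).
rewrite !B_rec (IHn _ _ (history_nested Hw)).
by have [_ _ ->] := historyS_draw Hw.
Qed.

(** Each of the [m] sampled balls brings at least one new ball, and [m > 0]. *)
Lemma total_growth n w : (m + n <= W n w + B n w)%N.
Proof.
elim: n => [|n IHn]; first by rewrite (urn_W0 urn) (urn_B0 urn) addn0.
rewrite W_rec B_rec addnACA addnS -addn1.
have [X0 Y0] := urn_pos urn w (isT : (0 < n.+1)%N).
have xm := urn_sample urn w (isT : (0 < n.+1)%N).
apply: leq_add => //; apply: (leq_trans m_gt0).
by rewrite -[leqLHS](subnKC xm) leq_add// leq_pmull.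
Qed.

Lemma total_gt0 n w : (0 < W n w + B n w)%N.
Proof. by apply: leq_trans (total_growth n w); rewrite addn_gt0 m_gt0. Qed.

Lemma total_cvg_pinfty w : (W n w)%:R + (B n w)%:R @[n --> \oo] --> (+oo : set_system R).
Proof.
apply/cvgryPge => M; near=> n.
apply: (@le_trans _ _ (n%:R : R)); first by near: n; exact: nbhs_infty_ger.
by rewrite -natrD ler_nat; apply: leq_trans (total_growth n w); rewrite leq_addl.
Unshelve. all: by end_near. Qed.

(** The conditional law of the sample, given on the atoms of the history, extends
    to functions of the sample by linearity: the sample takes the [m.+1] values
    0, ..., m. *)
Lemma integral_sample (h : nat -> R) n a : (forall k, 0 <= h k) ->
  (\int[P]_(w in history n @^-1` [set a]) (h (xi n.+1 w))%:E =
   \int[P]_(w in history n @^-1` [set a])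
     (\sum_(k < m.+1) h k * (('C(W n w, k) * 'C(B n w, m - k))%:R
        / 'C(W n w + B n w, m)%:R))%:E)%E.
Proof.
move=> h0; set A := history n @^-1` [set a].
have mA : measurable A by exact: history_discrete.
have mxi k : measurable (xi n.+1 @^-1` [set k]) by exact: discrete_rv.
pose g k w : R := ('C(W n w, k) * 'C(B n w, m - k))%:R / 'C(W n w + B n w, m)%:R.
have g0 k w : 0 <= g k w by rewrite divr_ge0.
have mg k : measurable_fun A (fun w => (g k w)%:E).
  apply: (determined_measurable_fun (history_discrete n)) => w w' Hw.
  by rewrite /g (W_adapted Hw) (B_adapted Hw).
transitivity (\int[P]_(w in A) \sum_(k < m.+1)
    ((h k)%:E * (\1_(xi n.+1 @^-1` [set (k : nat)]) w)%:E))%E.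
  apply: eq_integral => w _; have xm := urn_sample urn w (isT : (0 < n.+1)%N).
  have xm' : (xi n.+1 w < m.+1)%N by [].
  rewrite (bigD1 (Ordinal xm'))//= big1 ?adde0; last first.
    move=> k kx; rewrite indicE memNset ?mule0//= => xk.
    by move/eqP: kx; apply; apply: val_inj.
  by rewrite indicE mem_set// mule1.
transitivity (\int[P]_(w in A) \sum_(k < m.+1) ((h k)%:E * (g k w)%:E))%E; last first.
  by apply: eq_integral => w _; rewrite -sumEFin; apply: eq_bigr => k _.
have m1 k : measurable_fun A (fun w => (\1_(xi n.+1 @^-1` [set k]) w)%:E : \bar R).
  by apply/measurable_EFinP; exact: measurable_indic.
rewrite !ge0_integral_sum//; last 4 first.
- by move=> k; apply: emeasurable_funM.
- by move=> k w _; rewrite mule_ge0// lee_fin.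
- by move=> k; apply: emeasurable_funM.
- by move=> k w _; rewrite mule_ge0// lee_fin.
apply: eq_bigr => k _; rewrite !ge0_integralZl ?lee_fin//; last first.
  by move=> w _; rewrite lee_fin.
congr (_ * _)%E; rewrite integral_indic// setIC.
apply/esym.
exact: ((urn_draw urn (isT : (0 < n.+1)%N) (ltn_ord k : (k <= m)%N)).2 A
  (@draws_sigma_history n a)).
Qed.

Lemma white_sample_mean n a :
  (\int[P]_(w in history n @^-1` [set a]) (xi n.+1 w)%:R%:E =
   \int[P]_(w in history n @^-1` [set a])
     (m%:R * (W n w)%:R / (W n w + B n w)%:R)%:E)%E.
Proof.
rewrite (integral_sample (h := fun k => k%:R))//; apply: eq_integral => w _.
rewrite hypergeometric_mean ?total_gt0//.
by apply: leq_trans (total_growth n w); rewrite leq_addr.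
Qed.

Lemma blue_sample_mean n a :
  (\int[P]_(w in history n @^-1` [set a]) (m - xi n.+1 w)%N%:R%:E =
   \int[P]_(w in history n @^-1` [set a])
     (m%:R * (B n w)%:R / (W n w + B n w)%:R)%:E)%E.
Proof.
rewrite (integral_sample (h := fun k => (m - k)%N%:R))//; apply: eq_integral => w _.
rewrite hypergeometric_mean_compl ?total_gt0//.
by apply: leq_trans (total_growth n w); rewrite leq_addr.
Qed.

Lemma additions_indep n a (C : set nat) (D : set (nat * nat)) :
  P ((history n @^-1` [set a] `&` xi n.+1 @^-1` C) `&`
     [set w | D (X n.+1 w, Y n.+1 w)]) =
  (P (history n @^-1` [set a] `&` xi n.+1 @^-1` C) *
   P [set w | D (X n.+1 w, Y n.+1 w)])%E.
Proof.
rewrite setIC muleC; apply: (urn_indep urn (isT : (0 < n.+1)%N)).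
  by exists D.
rewrite /draws_sample_sigma /=; set G := (_ `|` _).
suff : @measurable _ (g_sigma_algebraType G)
  (history n @^-1` [set a] `&` xi n.+1 @^-1` C) by [].
apply: measurableI; apply: sub_sigma_algebra.
  by left; exact: draws_sigma_history.
by right; exists C.
Qed.

End urn_history.

(** * Asymptotics of the urn *)

Section moments.
Context {d : measure_display} {Omega : measurableType d} {R : realType}.
Variable P : probability Omega R.

Lemma mean_ge1 (Z : Omega -> nat) (mu : R) : discrete Z ->
  (forall w, (0 < Z w)%N) -> (\int[P]_w (Z w)%:R%:E = mu%:E)%E -> 1 <= mu.
Proof.
move=> dZ Z0 Zmu; rewrite -lee_fin -Zmu.
have -> : 1%:E = (\int[P]_w (cst 1%:E w))%E.
  by rewrite integral_cst// mul1e; exact/esym/probability_setT.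
apply: ge0_le_integral => //.
  by apply: (determined_measurable_fun dZ) => w w' ->.
by move=> w _; rewrite lee_fin ler1n.
Qed.

(** z^2 <= 2 (z - c)^2 + 2 c^2, where c is the mean. *)
Lemma second_moment_lty (Z : Omega -> nat) : discrete Z ->
  ('V_P[fun w => (Z w)%:R : R] < +oo)%E ->
  (\int[P]_w ((Z w)%:R ^+ 2)%:E < +oo :> \bar R)%E.
Proof.
move=> dZ; rewrite /variance covariance.unlock; set c := fine _.
rewrite expectation.unlock => var_lty.
have mZ (f : nat -> R) : measurable_fun [set: Omega] (fun w => (f (Z w))%:E).
  by apply: (determined_measurable_fun dZ) => w w' ->.
have c2 : 0 <= 2 * c ^+ 2 by rewrite mulr_ge0// sqr_ge0.
apply: (@le_lt_trans _ _ (\int[P]_w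
    (2%:E * (((Z w)%:R - c) ^+ 2)%:E + (cst (2 * c ^+ 2)%:E w)))%E).
  apply: ge0_le_integral => //.
  - exact: (mZ (fun j => j%:R ^+ 2)).
  - apply: emeasurable_funD => //.
    exact: (mZ (fun j => 2 * (j%:R - c) ^+ 2)).
  - move=> w _ /=; rewrite -EFinM -EFinD lee_fin -subr_ge0.
    by rewrite (_ : _ - _ = ((Z w)%:R - 2 * c) ^+ 2) ?sqr_ge0//; ring.
rewrite ge0_integralD//; last 2 first.
- by move=> w _; rewrite mule_ge0// lee_fin sqr_ge0.
- exact: (mZ (fun j => 2 * (j%:R - c) ^+ 2)).
rewrite integral_cst// lte_add_pinfty//; last first.
  by rewrite [X in (_ * X)%E](probability_setT P) mule1 ltry.
rewrite ge0_integralZl//; last 2 first.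
- exact: (mZ (fun j => (j%:R - c) ^+ 2)).
- by move=> w _; rewrite lee_fin sqr_ge0.
exact: lte_mul_pinfty.
Qed.

End moments.

Section urn_limits.
Context {d : measure_display} {Omega : measurableType d} {R : realType}.
Variables (P : probability Omega R) (m : nat).
Variables (X Y xi : nat -> {RV P >-> nat}).
Variables (w0 b0 : nat) (W B : nat -> Omega -> nat) (muX muY : R).
Hypothesis urn : diagonal_urn m X Y xi w0 b0 W B.
Hypothesis urn_start : (m <= w0 + b0)%N.
Hypothesis m_gt0 : (0 < m)%N.

Hypothesis meanX : (\int[P]_w (X 1%N w)%:R%:E = muX%:E)%E.
Hypothesis meanY : (\int[P]_w (Y 1%N w)%:R%:E = muY%:E)%E.
Hypothesis sqX : (\int[P]_w ((X 1%N w)%:R ^+ 2)%:E < +oo)%E.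
Hypothesis sqY : (\int[P]_w ((Y 1%N w)%:R ^+ 2)%:E < +oo)%E.

Let hist := history m X Y xi.
Let T n w := (W n w + B n w)%N.
Let s w := series (fun k => (T k w)%:R^-1 : R).

Let hist_discrete n : discrete (hist n).
Proof. exact: history_discrete. Qed.

Let hist_nested n : determined (hist n.+1) (hist n).
Proof. exact: history_nested. Qed.

Let T_adapted n : determined (hist n) (T n).
Proof. by move=> w w' Hw; rewrite /T (W_adapted urn Hw) (B_adapted urn Hw). Qed.

Let T_gt0 n w : (0 < T n w)%N.
Proof. exact: (total_gt0 urn urn_start m_gt0). Qed.

Lemma white_indep n a k j :
  (P ((hist n @^-1` [set a] `&` xi n.+1 @^-1` [set k]) `&` X n.+1 @^-1` [set j]) =
   P (hist n @^-1` [set a] `&` xi n.+1 @^-1` [set k]) * P (X n.+1 @^-1` [set j]))%E.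
Proof. exact: (additions_indep urn n a [set k] [set p | p.1 = j]). Qed.

Lemma blue_indep n a k j :
  (P ((hist n @^-1` [set a] `&` (fun w => m - xi n.+1 w)%N @^-1` [set k])
     `&` Y n.+1 @^-1` [set j]) =
   P (hist n @^-1` [set a] `&` (fun w => m - xi n.+1 w)%N @^-1` [set k]) *
   P (Y n.+1 @^-1` [set j]))%E.
Proof.
exact: (additions_indep urn n a [set i | (m - i)%N = k] [set p | p.2 = j]).
Qed.

Let compl_discrete n : discrete (fun w => m - xi n.+1 w)%N.
Proof.
move=> k; apply: (determined_preimage [set k] (discrete_rv (xi n.+1))).
by move=> w w' ->.
Qed.

Lemma white_growth : (0 < w0)%N -> {ae P, forall w, exists2 l : R, 0 < l &
  (W n w)%:R / expR (m%:R * muX * s w n) @[n --> \oo] --> l}.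
Proof.
move=> w0_gt0; apply: (ae_growth (H := hist) (U := W) (T := T)
  (A := fun n => X n.+1) (z := fun n => xi n.+1)) => //.
- exact: (W_adapted urn).
- by move=> n; exact: discrete_rv.
- by move=> n; exact: discrete_rv.
- by move=> n w; have [] := urn_pos urn w (isT : (0 < n.+1)%N).
- by move=> n w; exact: (urn_sample urn).
- exact: (W_rec urn).
- exact: white_indep.
- by move=> n j; exact: (urn_iidX urn).2.
- exact: (white_sample_mean urn).
- by move=> w; rewrite (urn_W0 urn).
Qed.

Lemma blue_growth : (0 < b0)%N -> {ae P, forall w, exists2 l : R, 0 < l &
  (B n w)%:R / expR (m%:R * muY * s w n) @[n --> \oo] --> l}.
Proof.
move=> b0_gt0; apply: (ae_growth (H := hist) (U := B) (T := T)
  (A := fun n => Y n.+1) (z := fun n w => m - xi n.+1 w)%N) => //.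
- exact: (B_adapted urn).
- by move=> n; exact: discrete_rv.
- by move=> n w; have [] := urn_pos urn w (isT : (0 < n.+1)%N).
- by move=> n w; exact: leq_subr.
- exact: (B_rec urn).
- exact: blue_indep.
- by move=> n j; exact: (urn_iidY urn).2.
- exact: (blue_sample_mean urn).
- by move=> w; rewrite (urn_B0 urn).
Qed.

Lemma blue_absent : b0 = 0%N -> {ae P, forall w n, B n w = 0%N}.
Proof.
move=> b0_eq0; apply: (absorbed_at_zero (m := m) (H := hist) (U := B) (T := T)
  (A := fun n => Y n.+1) (z := fun n w => m - xi n.+1 w)%N) => //.
- exact: (B_adapted urn).
- exact: (B_rec urn).
- exact: (blue_sample_mean urn).
- by move=> w; rewrite (urn_B0 urn).
Qed.

(** Without blue balls at the start the limit is zero, by [blue_absent]. *)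
Lemma blue_growth_weak : {ae P, forall w, exists2 l : R, 0 <= l &
  (B n w)%:R / expR (m%:R * muY * s w n) @[n --> \oo] --> l}.
Proof.
have [b0_eq0|] := posnP b0; last first.
  by move=> /blue_growth; apply: filterS => w [l /ltW l0 Bl]; exists l.
have := blue_absent b0_eq0; apply: filterS => w Bw; exists 0 => //.
rewrite (_ : (fun n => _ / _) = (fun=> 0)); first exact: cvg_cst.
by apply/funext => n; rewrite Bw mul0r.
Qed.

End urn_limits.

Theorem theorem4 (d : measure_display) (Omega : measurableType d)
  (R : realType) (P : probability Omega R) (m : nat)
  (X Y xi : nat -> {RV P >-> nat}) (W B : nat -> Omega -> nat)
  (w0 b0 : nat) (muX muY : R)
  (hm : (1 <= m)%N)
  (hT0 : (m <= w0 + b0)%N)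
  (hw0 : (0 < w0)%N)
  (hurn : diagonal_urn m X Y xi w0 b0 W B)
  (hmuX : ('E_P[fun w => (X 1%N w)%:R : R] = muX%:E)%E)
  (hmuY : ('E_P[fun w => (Y 1%N w)%:R : R] = muY%:E)%E)
  (hvarX : ('V_P[fun w => (X 1%N w)%:R : R] < +oo)%E)
  (hvarY : ('V_P[fun w => (Y 1%N w)%:R : R] < +oo)%E) :
  (muY < muX -> (0 < b0)%N ->
   exists Binf : {RV P >-> R},
     (forall w, 0 < Binf w) /\
     {ae P, forall w,
       [/\ (fun n : nat => (W n w + B n w)%:R : R^o)
             = (fun n => m%:R * muX * n%:R) +o_\oo (fun n => n%:R : R^o),
           (fun n : nat => (W n w)%:R : R^o)
             = (fun n => m%:R * muX * n%:R) +o_\oo (fun n => n%:R : R^o)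
         & (fun n : nat => (B n w)%:R : R^o)
             = (fun n => Binf w * n%:R `^ (muY / muX))
               +o_\oo (fun n => n%:R `^ (muY / muX) : R^o)]}) /\
  (muX = muY ->
   exists Winf : {RV P >-> R},
     (forall w, 0 < Winf w) /\
     {ae P, forall w,
       [/\ (fun n : nat => (W n w + B n w)%:R : R^o)
             = (fun n => m%:R * muX * n%:R) +o_\oo (fun n => n%:R : R^o),
           (fun n : nat => (W n w)%:R : R^o)
             = (fun n => Winf w * n%:R) +o_\oo (fun n => n%:R : R^o)
         & (fun n : nat => (B n w)%:R : R^o)
             = (fun n => (muX * m%:R - Winf w) * n%:R)
               +o_\oo (fun n => n%:R : R^o)]}).
Proof.
have X1_gt0 w : (0 < X 1%N w)%N by have [] := urn_pos hurn w (isT : (0 < 1)%N).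
have Y1_gt0 w : (0 < Y 1%N w)%N by have [] := urn_pos hurn w (isT : (0 < 1)%N).
have meanX : (\int[P]_w (X 1%N w)%:R%:E = muX%:E)%E.
  by rewrite -hmuX expectation.unlock.
have meanY : (\int[P]_w (Y 1%N w)%:R%:E = muY%:E)%E.
  by rewrite -hmuY expectation.unlock.
have sqX := second_moment_lty (discrete_rv (X 1%N)) hvarX.
have sqY := second_moment_lty (discrete_rv (Y 1%N)) hvarY.
have muX1 := mean_ge1 (discrete_rv (X 1%N)) X1_gt0 meanX.
have muY1 := mean_ge1 (discrete_rv (Y 1%N)) Y1_gt0 meanY.
have muX0 : 0 < muX by exact: lt_le_trans muX1.
have muY0 : 0 < muY by exact: lt_le_trans muY1.
have m0 : 0 < m%:R :> R by rewrite ltr0n.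
have wg := white_growth hurn hT0 hm meanX sqX hw0.
have sE w : series (fun k => (W k w + B k w)%:R^-1 : R) =
    series (fun k => ((W k w)%:R + (B k w)%:R)^-1).
  by under eq_fun do rewrite natrD.
have T_gt0 w n : 0 < (W n w)%:R + (B n w)%:R :> R.
  by rewrite -natrD ltr0n (total_gt0 hurn).
have T_oo := total_cvg_pinfty hurn hT0 hm.
have near_gt0 : \forall n \near \oo, 0 < n%:R :> R.
  by near=> n; rewrite ltr0n; near: n; exact: nbhs_infty_gt.
have measurable_count (V : nat -> Omega -> nat) (e : R ^nat) n :
    (forall n, determined (history m X Y xi n) (V n)) ->
    measurable_fun [set: Omega] (fun w => (V n w)%:R / e n : R).
  move=> dV; apply: (determined_measurable_fun (history_discrete m X Y xi n)).
  by move=> w w' /dV ->.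
split=> [muYX b0_gt0|muXY].
  have bg := blue_growth hurn hT0 hm meanY sqY b0_gt0.
  have [Binf [Binf0 BinfE]] := positive_limit_rv P (fun n =>
    measurable_count B (fun n => n%:R `^ (muY / muX)) n (B_adapted hurn)).
  exists Binf; split => //.
  apply: filterS2 wg bg => w [a a0 Wa] [b b0' Bb].
  rewrite sE in Wa; rewrite sE in Bb.
  have cmp : 0 < m%:R * muY < m%:R * muX by rewrite mulr_gt0//= ltr_pM2l.
  have [Tl Wl [l l0 Bl]] := dominant_color_asymptotics cmp a0 b0'
    (T_gt0 w) (T_oo w) Wa Bb.
  have rho : m%:R * muY / (m%:R * muX) = muY / muX.
    by field; rewrite !gt_eqF.
  rewrite rho in Bl.
  split; apply: cvg_littleo_near => //.
  - by under eq_cvg do rewrite natrD.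
  - by apply: filterS near_gt0 => n n0; rewrite powR_gt0.
  - by rewrite (BinfE w l l0 Bl).
rewrite -muXY in meanY.
have bg := blue_growth_weak hurn hT0 hm meanY sqY.
have [Winf [Winf0 WinfE]] := positive_limit_rv P (fun n =>
  measurable_count W (fun n => n%:R) n (W_adapted hurn)).
exists Winf; split => //.
apply: filterS2 wg bg => w [a a0 Wa] [b b0' Bb].
rewrite sE in Wa; rewrite sE in Bb.
have [Tl [l l0 Wl]] := balanced_asymptotics (mulr_gt0 m0 muX0) a0 b0'
  (T_gt0 w) (T_oo w) Wa Bb.
have Wlim := WinfE w l l0 Wl.
split; apply: cvg_littleo_near => //.
- by under eq_cvg do rewrite natrD.
- by rewrite Wlim.
rewrite Wlim (mulrC muX).
have TWl : ((W n w)%:R + (B n w)%:R) / n%:R - (W n w)%:R / n%:R @[n --> \oo]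
    --> m%:R * muX - l by exact: cvgB.
apply: (cvg_near_eq TWl); apply: nearW => n.
by rewrite -mulrBl addrAC subrr add0r.
Unshelve. all: by end_near. Qed.
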